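(* Let $T$ be a rising tree or a progressing tree with discriminator $D$ and Farey-indexed numbers $m_{k/n}=m(T)_{k/n}$. There is a continuous function $\Phi=\Phi_T:[0,1]\to\mathbb R_{\ge 0}$ that encodes these numbers with $$m_{k/n}=2\cosh\bigl(n\cdot\Phi(k/n)\bigr)\qquad\text{for all reduced fractions } k/n\in\mathbb Q\cap[0,1].$$ The graph of $\Phi$ is strictly convex if $D<4$, a straight line if $D=4$, and strictly concave if $D>4$. Also, $\Phi$ is differentiable at every irrational number in $(0,1)$. If $D\neq4$ then at rational numbers $\Phi$ is only semi-differentiable: the left derivative exists at every rational $q\in(0,1]$ and the right derivative exists at every rational $q\in[0,1)$ (where the right derivative at $0$ is $+\infty$ when $m_0=2$ and the left derivative at $1$ is $-\infty$ when $m_1=2$), and the left and right derivatives are different at every rational $q\in(0,1)$.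
   Context: All fractions $k/n$ are in lowest terms with $n\ge1$. Two fractions $a/b<c/d$ in $[0,1]$ are Farey neighbours if $bc-ad=1$; their mediant is $(a+c)/(b+d)$. Each $q\in\mathbb Q\cap(0,1)$ is the mediant of a unique pair of Farey neighbours in $[0,1]$, denoted $q_0<q_0'$. A real Markov tree $T$ with base triple $(s_0,u_0,t_0)\in\mathbb R^3$ is a rooted planar trivalent tree (the root has degree 1, all other vertices degree 3) whose complementary regions carry real labels; the root edge has the region $s_0$ on its left, $t_0$ on its right, and leads to the region $u_0$; and for every non-root edge, with regions $s,t$ on its two sides and regions $r,u$ at its two ends, $r+u=st$. The regions are Farey-indexed by $\mathbb Q\cap[0,1]$, writing $m_q=m(T)_q$: $m_0=s_0$, $m_{1/2}=u_0$, $m_1=t_0$, and for each $q\in\mathbb Q\cap(0,1)$, if $p$ is the mediant of $q_0,q$ and $p'$ the mediant of $q,q_0'$, then $m_p=m_{q_0}m_q-m_{q_0'}$ and $m_{p'}=m_qm_{q_0'}-m_{q_0}$. The non-root vertices correspond to $q\in\mathbb Q\cap(0,1)$: the regions $q_0,q,q_0'$ meet at vertex $q$. Let $e_q$ be the edge at vertex $q$ on the side of the root. It is (positively) directed away from the root if $2m_q-m_{q_0}m_{q_0'}>0$, towards the root if this number is negative, and undirected if it is $0$. The discriminator is $D=s_0^2+u_0^2+t_0^2-s_0u_0t_0$; the labels $r,s,t$ at every non-root vertex satisfy $r^2+s^2+t^2-rst=D$. $T$ is a rising tree if all labels are $>2$ and all edges are positively directed away from the root except for those on a finite (possibly empty)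 simple path starting at the root. $T$ is a progressing tree if $2\le s_0<u_0$, $2\le t_0<u_0$ and $(s_0-2)(t_0-2)=0$. *)

(* Defs.v *)
From mathcomp Require Import all_boot all_order all_algebra.
From mathcomp Require Import all_classical all_reals all_analysis.
Import Order.TTheory GRing.Theory Num.Theory.
Import numFieldNormedType.Exports.

Set Implicit Arguments.
Unset Strict Implicit.
Unset Printing Implicit Defensive.

Local Open Scope classical_set_scope.
Local Open Scope ring_scope.

Definition farey_neighbours (x y : rat) : Prop :=
  [/\ 0 <= x, x < y, y <= 1 & numq y * denq x - numq x * denq y = 1].

Definition mediant (x y : rat) : rat :=
  (numq x + numq y)%:~R / (denq x + denq y)%:~R.

(* Regions are indexed by the rationals of [0, 1]; the values of [label]
   outside [0, 1] are junk.  The non-root vertex q is the mediant of a unique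
   Farey pair (x, y), so that the regions x, q, y meet there.  The edge from q
   to its child mediant x q has x and q on its sides, and y and mediant x q at
   its ends; symmetrically for the child mediant q y. *)
Record markov_tree (R : realType) (s0 u0 t0 : R) := MarkovTree {
  label :> rat -> R;
  label_0 : label 0 = s0;
  label_half : label (1 / 2) = u0;
  label_1 : label 1 = t0;
  label_left : forall x y, farey_neighbours x y ->
    label (mediant x (mediant x y)) = label x * label (mediant x y) - label y;
  label_right : forall x y, farey_neighbours x y ->
    label (mediant (mediant x y) y) = label (mediant x y) * label y - label x
}.

Definition discriminator (R : realType) (s0 u0 t0 : R) : R :=
  s0 ^+ 2 + u0 ^+ 2 + t0 ^+ 2 - s0 * u0 * t0.

(* Direction of the edge e_q on the root side of the vertex q = mediant x y. *)
Definition directed_away (R : realType) (s0 u0 t0 : R)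
    (T : markov_tree s0 u0 t0) (x y : rat) : Prop :=
  0 < 2 * T (mediant x y) - T x * T y.

Definition child (q p : rat) : Prop :=
  exists x y, [/\ farey_neighbours x y, q = mediant x y
    & p = mediant x q \/ p = mediant q y].

(* Finite simple paths starting at the root, as the list of the non-root
   vertices q visited; the edges of the path are the corresponding e_q. *)
Inductive root_path : seq rat -> Prop :=
| root_path_nil : root_path [::]
| root_path_root_edge : root_path [:: 1 / 2]
| root_path_rcons s q p :
    root_path (rcons s q) -> child q p -> root_path (rcons (rcons s q) p).

Definition rising (R : realType) (s0 u0 t0 : R)
    (T : markov_tree s0 u0 t0) : Prop :=
  (forall q : rat, 0 <= q <= 1 -> 2 < T q) /\
  (exists2 s : seq rat, root_path s &
     forall x y, farey_neighbours x y -> mediant x y \notin s ->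
       directed_away T x y).

Definition progressing (R : realType) (s0 u0 t0 : R)
    (T : markov_tree s0 u0 t0) : Prop :=
  [/\ 2 <= s0 < u0, 2 <= t0 < u0 & (s0 - 2) * (t0 - 2) = 0].

Definition cosh (R : realType) (x : R) : R := (expR x + expR (- x)) / 2.

Definition strictly_convex_on (R : realType) (a b : R) (f : R -> R) : Prop :=
  forall x y t : R, a <= x -> x < y -> y <= b -> 0 < t < 1 ->
    f ((1 - t) * x + t * y) < (1 - t) * f x + t * f y.

Definition strictly_concave_on (R : realType) (a b : R) (f : R -> R) : Prop :=
  forall x y t : R, a <= x -> x < y -> y <= b -> 0 < t < 1 ->
    (1 - t) * f x + t * f y < f ((1 - t) * x + t * y).

Definition affine_on (R : realType) (a b : R) (f : R -> R) : Prop :=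
  exists c d : R, forall x, a <= x <= b -> f x = c * x + d.

(* One-sided derivatives, with values in the extended reals. *)
Definition has_right_derivative (R : realType) (f : R -> R) (x : R)
    (l : \bar R) : Prop :=
  (h^-1 * (f (x + h) - f x))%:E @[h --> 0^'+] --> l.

Definition has_left_derivative (R : realType) (f : R -> R) (x : R)
    (l : \bar R) : Prop :=
  (h^-1 * (f (x + h) - f x))%:E @[h --> 0^'-] --> l.

(* Main.v *)
(* Write m_q = mu_q + 1 / mu_q with mu_q >= 1 and F(q) = ln mu_q, so that the
   function sought is Phi(k/n) = F(k/n) / n on rationals. For Farey neighbours
   q, y the labels along the iterated mediants n q + y satisfy a linear
   recurrence, hence equal A mu_q^n + B mu_q^-n, and the invariance of D becomes
   A B = 1 + (4 - D) / (m_q^2 - 4), A + B = m_y. So ln A plays the role of the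
   directional derivative of F at q towards y. Comparing A, B with mu_y, 1/mu_y,
   which have the same sum but product 1, shows (using for D > 4 that all edges
   are directed away from the root) that, up to the sign of 4 - D, each
   chord between Farey neighbours has slope between the right slope r at its
   left end and the left slope l at its right end; and r(q) - l(q) is a positive
   multiple of |ln (A B)|. As l < r at interior rationals, these bounds chain up
   to all pairs of rationals, so that (up to sign) Phi is strictly convex on
   rationals. Its extension to the reals is the supremum of its tangents at
   rationals. At an irrational number, l(y) - r(x) tends to 0 along the Farey
   intervals [x, y] around it, because labels grow fast enough where the edges
   are directed away from the root. *)
Require Import Defs.
From mathcomp Require Import all_boot all_order all_algebra.
From mathcomp Require Import all_classical all_reals all_analysis.
From mathcomp Require Import ring lra zify.
Import Order.TTheory GRing.Theory Num.Theory.
Import numFieldNormedType.Exports.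
Local Open Scope classical_set_scope.
Local Open Scope ring_scope.

Set Implicit Arguments.
Unset Strict Implicit.
Unset Printing Implicit Defensive.

(** * Farey neighbours *)

Lemma lt_rat_det (x y : rat) :
  (x < y) = (numq x * denq y < numq y * denq x).
Proof. by rewrite -lt_ratE. Qed.

Lemma le_rat_det (x y : rat) :
  (x <= y) = (numq x * denq y <= numq y * denq x).
Proof. by rewrite -le_ratE. Qed.

Lemma le1_rat_det (x : rat) : (x <= 1) = (numq x <= denq x).
Proof. by rewrite le_rat_det -[1]/(1%:Q) numq_int denq_int mulr1 mul1r. Qed.

Lemma fareyE (x y : rat) : farey_neighbours x y <->
  [/\ 0 <= numq x, numq y <= denq y & numq y * denq x - numq x * denq y = 1].
Proof.
rewrite /farey_neighbours numq_ge0 -le1_rat_det; split=> [[]//|[x0 y1 h]].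
by split=> //; rewrite lt_rat_det; lia.
Qed.

Lemma farey_bounds (x y : rat) : farey_neighbours x y ->
  [/\ 0 <= x, x <= 1, 0 <= y & y <= 1].
Proof.
by move=> [x0 xy y1 _]; split=> //; [exact: (le_trans (ltW xy)) | exact: (le_trans x0 (ltW xy))].
Qed.

Lemma numden_mediant (x y : rat) : farey_neighbours x y ->
  numq (mediant x y) = numq x + numq y /\ denq (mediant x y) = denq x + denq y.
Proof.
move=> [x0 xy y1 h].
have dx := denq_gt0 x; have dy := denq_gt0 y.
have cop : coprime `|numq x + numq y| `|denq x + denq y|.
  have : coprimez (numq x + numq y) (denq x + denq y).
    (* The Farey determinant is a Bezout relation for the two sums, so the mediant is already in
       lowest terms. *)
    by apply/coprimezP; exists (denq x, - numq x) => /=; lia.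
  by [].
rewrite /mediant coprimeq_num // coprimeq_den //.
by rewrite gtr0_sg ?addr_gt0 // mul1r; split=> //; case: eqP => //; lia.
Qed.

Lemma farey_mediantl (x y : rat) : farey_neighbours x y ->
  farey_neighbours x (mediant x y).
Proof.
move=> f; apply/fareyE; have [-> ->] := numden_mediant f.
move: f => /fareyE [x0 y1 h].
have dx := denq_gt0 x; have dy := denq_gt0 y.
by split=> //; nia.
Qed.

Lemma farey_mediantr (x y : rat) : farey_neighbours x y ->
  farey_neighbours (mediant x y) y.
Proof.
move=> f; apply/fareyE; have [-> ->] := numden_mediant f.
move: f => /fareyE [x0 y1 h].
have dx := denq_gt0 x; have dy := denq_gt0 y.
by split=> //; nia.
Qed.

Lemma rat_eq_numden (x y : rat) : numq x = numq y -> denq x = denq y -> x = y.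
Proof. by move=> hn hd; apply/eqP; rewrite rat_eqE hn hd !eqxx. Qed.

Lemma mediant_between (x y : rat) : farey_neighbours x y -> x < mediant x y < y.
Proof.
by move=> f; case: (farey_mediantl f) => _ -> _ _; case: (farey_mediantr f) => _ -> _ _.
Qed.

(** [denq u] is a combination of [denq y] and [denq x] whose coefficients, the determinants of x, u
    and of u, y, are positive integers. *)
Lemma farey_denq_between (x y u : rat) : farey_neighbours x y -> x < u < y ->
  denq x + denq y <= denq u.
Proof.
move=> /fareyE[x0 y1 h]; rewrite !lt_rat_det => /andP[xu uy].
have dx := denq_gt0 x; have dy := denq_gt0 y.
have -> : denq u = (numq u * denq x - numq x * denq u) * denq y
   + (numq y * denq u - numq u * denq y) * denq x.
  transitivity (denq u * (numq y * denq x - numq x * denq y)); last by ring.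
  by rewrite h mulr1.
by nia.
Qed.

(** Induction along the path in the Farey tree from [x, y] down to [u]. It ends because
    [denq u - (denq x + denq y)] is nonnegative by [farey_denq_between] and drops when an end is
    replaced by the mediant. *)
Lemma farey_descent (P : rat -> rat -> rat -> Prop) :
  (forall x y, farey_neighbours x y -> P x y (mediant x y)) ->
  (forall x y (u : rat), farey_neighbours x y -> x < u < mediant x y ->
     P x (mediant x y) u -> P x y u) ->
  (forall x y (u : rat), farey_neighbours x y -> mediant x y < u < y ->
     P (mediant x y) y u -> P x y u) ->
  forall x y (u : rat), farey_neighbours x y -> x < u < y -> P x y u.
Proof.
move=> Pm Pl Pr x y u.
have [n] := ubnP `|(denq u - (denq x + denq y))%R|%N.
elim: n x y => // n IH x y le_n f xuy; have le_d := farey_denq_between f xuy.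
have [_ dm] := numden_mediant f.
have dx := denq_gt0 x; have dy := denq_gt0 y.
case/andP: xuy => xu uy; have [um|mu|->] := ltgtP u (mediant x y).
- have fl := farey_mediantl f; have b : x < u < mediant x y by rewrite xu.
  have := farey_denq_between fl b; rewrite dm => ?.
  by apply: Pl => //; apply: IH => //; rewrite dm; lia.
- have fr := farey_mediantr f; have b : mediant x y < u < y by rewrite mu.
  have := farey_denq_between fr b; rewrite dm => ?.
  by apply: Pr => //; apply: IH => //; rewrite dm; lia.
- exact: Pm.
Qed.

Lemma farey01 : farey_neighbours 0 1. Proof. by []. Qed.

Lemma farey_parents (q : rat) : 0 < q < 1 ->
  exists x y, farey_neighbours x y /\ q = mediant x y.
Proof.
apply: (farey_descent (P := fun _ _ u => exists x y,
  farey_neighbours x y /\ u = mediant x y)) => //.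
by move=> x y f; exists x, y.
Qed.

(* To be applied to the relation: the slope of the chord on [x, z] is at least
   the right slope at x and at most the left slope at z. *)
Lemma farey_chain (E : rat -> rat -> Prop) :
  (forall x y, farey_neighbours x y -> E x y) ->
  (forall x y z, 0 <= x -> x < y -> y < z -> z <= 1 -> E x y -> E y z -> E x z) ->
  forall x z, 0 <= x -> x < z -> z <= 1 -> E x z.
Proof.
move=> Ef Et.
have Ein x y u : farey_neighbours x y -> x < u < y -> E x u /\ E u y.
  apply: (farey_descent (P := fun x y u => E x u /\ E u y)) => {x y u}.
  - move=> x y f.
    by split; apply: Ef; [exact: farey_mediantl | exact: farey_mediantr].
  - move=> x y u f /andP[xu um] [Exu Eum]; split=> //.
    have fr := farey_mediantr f; have [? ? ? ?] := farey_bounds f.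
    apply: (Et _ (mediant x y)) => //; last exact: Ef.
      by case: f => x0 _ _ _; rewrite (le_trans x0) ?ltW.
    by case/andP: (mediant_between f).
  - move=> x y u f /andP[mu uy] [Emu Euy]; split=> //.
    have fl := farey_mediantl f; have [? ? ? y1] := farey_bounds f.
    apply: (Et _ (mediant x y)) => //; [|exact: ltW (lt_le_trans uy y1)|exact: Ef].
    by case/andP: (mediant_between f).
(* Induction on [denq x]: if [z] lies beyond the right parent [b] of [x], whose denominator is
   smaller, the chain passes through [b]. *)
move=> x z; have [n] := ubnP `|denq x|%N.
elim: n x => // n IH x le_n x0 xz z1.
have [x0'|xn0] := eqVneq x 0.
  have [->|zn1] := eqVneq z 1; first by rewrite x0'; exact: Ef.
  rewrite x0' in xz *; apply: (proj1 (Ein 0 1 z _ _)) => //.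
  by rewrite xz lt_neqAle zn1.
have x01 : 0 < x < 1 by rewrite lt_neqAle eq_sym xn0 x0 (lt_le_trans xz).
have [a [b [f xE]]] := farey_parents x01.
have fr := farey_mediantr f; have [_ dm] := numden_mediant f; rewrite -xE in fr dm.
have [zb|bz|->] := ltgtP z b; last exact: Ef.
  by apply: (proj1 (Ein x b z _ _)) => //; rewrite xz.
have xb : x < b by case: fr.
apply: (Et _ b) => //; first exact: Ef.
have da := denq_gt0 a; have db := denq_gt0 b.
by apply: IH => //; [lia | exact: le_trans x0 (ltW xb)].
Qed.

(** * Neighbours of a fraction on a given side *)

Lemma mediantC (x y : rat) : mediant x y = mediant y x.
Proof. by rewrite /mediant addrC [denq x + _]addrC. Qed.

Definition fdet (x y : rat) : int := numq y * denq x - numq x * denq y.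

(* Farey neighbours in either order, the boolean telling whether q < y. *)
Definition farey_adjacent (b : bool) (q y : rat) : Prop :=
  if b then farey_neighbours q y else farey_neighbours y q.

Lemma adjacent_det b q y : farey_adjacent b q y -> fdet q y = (-1) ^+ (~~ b).
Proof. by case: b => /fareyE[_ _]; rewrite /fdet /= ?expr0 ?expr1; lia. Qed.

Lemma adjacent_bounds b q y : farey_adjacent b q y ->
  [/\ 0 <= q, q <= 1, 0 <= y & y <= 1].
Proof. by case: b => /farey_bounds[]. Qed.

Lemma adjacent_numden b q y : farey_adjacent b q y ->
  numq (mediant q y) = numq q + numq y /\ denq (mediant q y) = denq q + denq y.
Proof.
case: b; first exact: numden_mediant.
by rewrite mediantC => /numden_mediant[-> ->]; rewrite addrC [denq y + _]addrC.
Qed.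

Lemma adjacent_mediant b q y : farey_adjacent b q y -> farey_adjacent b q (mediant q y).
Proof. by case: b; [exact: farey_mediantl | rewrite mediantC; exact: farey_mediantr]. Qed.

Lemma adjacent_iter b q y n : farey_adjacent b q y ->
  [/\ farey_adjacent b q (iter n (mediant q) y),
      numq (iter n (mediant q) y) = numq q *+ n + numq y &
      denq (iter n (mediant q) y) = denq q *+ n + denq y].
Proof.
move=> a; elim: n => [|n [an nn dn]] /=; first by rewrite !mulr0n !add0r.
have [-> ->] := adjacent_numden an; rewrite nn dn !addrA -!mulrS.
by split=> //; exact: adjacent_mediant.
Qed.

(** Both have the same determinant with [q], so their vectors (numerator, denominator) differ by a
    multiple of that of [q], which is primitive. *)
Lemma adjacent_same_side b q y z : farey_adjacent b q y -> farey_adjacent b q z ->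
  denq y <= denq z -> exists n, z = iter n (mediant q) y.
Proof.
move=> ay az dyz; have := adjacent_det ay; rewrite -(adjacent_det az) /fdet => h.
have dq := denq_gt0 q.
have e : (numq z - numq y) * denq q = numq q * (denq z - denq y) by lia.
have : (denq q %| denq z - denq y)%Z.
  rewrite -(@Gauss_dvdzr _ (numq q)); first by rewrite -e dvdz_mull.
  by rewrite /coprimez /gcdz gcdnC (eqP (coprime_num_den q)).
case/dvdzP => k dk; have k0 : 0 <= k.
  rewrite -(pmulr_lge0 _ dq).
  by rewrite -dk subr_ge0.
exists `|k|%N; have [_ nn dn] := adjacent_iter `|k|%N ay.
apply: rat_eq_numden; rewrite ?nn ?dn.
  have : (numq z - numq y) * denq q = (numq q * k) * denq q by rewrite e dk; ring.
  move/(mulIf (lt0r_neq0 dq)) => e2.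
  by rewrite -[numq z](subrK (numq y)) e2 -mulr_natr natz gez0_abs.
by rewrite -[denq z](subrK (denq y)) dk -mulr_natr natz gez0_abs // mulrC.
Qed.

(** Reduces independence of the chosen neighbour to a comparison with one mediant. *)
Lemma adjacent_ind_side b q (P : rat -> rat -> Prop) :
  (forall x, P x x) -> (forall x y, P x y -> P y x) ->
  (forall x y z, P x y -> P y z -> P x z) ->
  (forall y, farey_adjacent b q y -> P y (mediant q y)) ->
  forall y z, farey_adjacent b q y -> farey_adjacent b q z -> P y z.
Proof.
move=> Pr Ps Pt Pm.
have Pi y n : farey_adjacent b q y -> P y (iter n (mediant q) y).
  move=> a; elim: n => [|n IH] //=; apply: (Pt _ _ _ IH); apply: Pm.
  by case: (adjacent_iter n a).
move=> y z ay az; have [dyz|/ltW dzy] := leP (denq y) (denq z).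
  by have [n ->] := adjacent_same_side ay az dyz; exact: Pi.
by have [n ->] := adjacent_same_side az ay dzy; apply: Ps; exact: Pi.
Qed.

(** * Farey approximation of irrational numbers *)

Section Approximation.
Variable R : realType.
Implicit Types (x y q : rat) (xi : R).

Definition den x : R := (denq x)%:~R.

Lemma den_ge1 x : 1 <= den x.
Proof. by rewrite /den -[1]/(1%:~R) ler_int; exact: denq_gt0. Qed.

Lemma den_gt0 x : 0 < den x.
Proof. exact: lt_le_trans (den_ge1 x). Qed.

Lemma ratr_den x : ratr x * den x = (numq x)%:~R :> R.
Proof. by rewrite /ratr divfK // intr_eq0 denq_neq0. Qed.

Lemma ratr_det x y : ratr y - ratr x = (fdet x y)%:~R / (den x * den y) :> R.
Proof.
have := den_gt0 x; have := den_gt0 y; have := ratr_den x; have := ratr_den y.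
rewrite /fdet /den rmorphB !rmorphM /= => <- <- y0 x0.
by field; rewrite !gt_eqF.
Qed.

Lemma adjacent_ratr b x y : farey_adjacent b x y ->
  ratr y - ratr x = (-1) ^+ (~~ b) / (den x * den y) :> R.
Proof. by move/adjacent_det=> h; rewrite ratr_det h rmorphXn rmorphN1. Qed.

Definition brackets b q y xi :=
  if b then ratr q < xi < ratr y else ratr y < xi < ratr q.

(** [y] moves towards [q] by mediants with [q] until it passes [xi]; the last two iterates then
    enclose [xi]. *)
Lemma adjacent_step b q y xi : irrational xi -> farey_adjacent b q y ->
  brackets b q y xi -> exists q' y', [/\ farey_adjacent b q' y', brackets b q' y' xi,
    denq q < denq q' & denq y <= denq y'].
Proof.
move=> irr a br; pose z n := iter n (mediant q) y.
have az n : [/\ farey_adjacent b q (z n), numq (z n) = numq q *+ n + numq y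
    & denq (z n) = denq q *+ n + denq y] by exact: adjacent_iter.
have ex : exists n, ~~ `[< brackets b q (z n) xi >].
  (* If no iterate passed [xi], then [xi] would be closer to [q] than all of them, hence within 1 /
     (n + 1) for every n. *)
  apply/not_existsP => all_br.
  have xq : 0 < `|xi - ratr q|.
    rewrite normr_gt0 subr_eq0; apply/eqP => e; apply: irr.
    by exists q.
  have bd n : `|xi - ratr q| < n.+1%:R^-1.
    have /negP/negPn/asboolP brn := all_br n.
    have [an _ dnn] := az n.
    have h : `|ratr (z n) - ratr q| <= n.+1%:R^-1 :> R.
      rewrite (adjacent_ratr an) normrM normfV normrX normrN1 expr1n mul1r.
      rewrite gtr0_norm ?mulr_gt0 ?den_gt0 // lef_pV2 ?posrE ?mulr_gt0 ?den_gt0 //.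
      apply: (@le_trans _ _ (den (z n))); last first.
        by rewrite ler_peMl ?den_ge1 // ltW ?den_gt0.
      rewrite /den dnn -[n.+1%:R]/(n.+1%:~R) ler_int.
      by have := denq_gt0 q; have := denq_gt0 y; nia.
    apply: lt_le_trans h; move: brn; rewrite /brackets.
    case: b {a br az an all_br} => /andP[h1 h2].
      by rewrite !gtr0_norm ?subr_gt0 // ?ltrD2r // (lt_trans h1).
    by rewrite !ltr0_norm ?subr_lt0 // ?ltrN2 ?ltrD2r // (lt_trans h1).
  have := bd (Num.bound `|xi - ratr q|^-1); apply/negP; rewrite -leNgt.
  rewrite invf_ple ?posrE // -natr1.
  by rewrite (le_trans (ltW (archi_boundP _))) ?invr_ge0 // lerDl.
case: (ex_minnP ex) => n nb nmin.
case: n nb nmin => [|n]; first by move/negP; case; apply/asboolP.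
move=> nb nmin.
have brn : brackets b q (z n) xi.
  by apply: contrapT => /asboolPn/nmin; rewrite ltnn.
have [an _ dnn] := az n; have [an1 _ dn1] := az n.+1.
exists (z n.+1), (z n); split.
- move: an; rewrite /z /= -/(z n); case: b {a br az ex brn nb nmin an1} => an.
    exact: farey_mediantr.
  by rewrite mediantC; exact: farey_mediantl.
- move: nb brn => /asboolPn; rewrite /brackets.
  have ne : ratr (z n.+1) != xi.
    by apply/eqP => e; apply: irr; exists (z n.+1).
  case: b {a br az ex nmin an an1} => nb /andP[h1 h2]; apply/andP; split=> //.
    by rewrite ltNge; apply/negP => h; apply: nb; rewrite h1 lt_neqAle eq_sym ne h.
  by rewrite ltNge; apply/negP => h; apply: nb; rewrite h2 lt_neqAle ne h.
- by rewrite dn1; have := denq_gt0 q; have := denq_gt0 y; nia.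
- by rewrite dnn; have := denq_gt0 q; nia.
Qed.

Lemma farey_approximation xi (n : nat) : 0 < xi < 1 -> irrational xi ->
  exists x y, [/\ farey_neighbours x y, ratr x < xi < ratr y,
    n%:Z <= denq x & n%:Z <= denq y].
Proof.
move=> xi01 irr; elim: n => [|n [x [y [f br hx hy]]]].
  by exists 0, 1; rewrite rmorph0 rmorph1; split.
(* One step from each side, so that both denominators grow. *)
have [x' [y' [f' br' hx' hy']]] := @adjacent_step true x y xi irr f br.
have [y'' [x'' [f'' br'' hy'' hx'']]] := @adjacent_step false y' x' xi irr f' br'.
exists x'', y''; split=> //; lia.
Qed.

End Approximation.

(** * Growth along linear recurrences *)

Section HyperbolicEigenvalue.
Variable R : realType.
Implicit Types m k p s : R.

(* The larger root of [x ^ 2 - m x + 1], so that m = 2 cosh (ln (mu m)). *)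
Definition mu m : R := (m + Num.sqrt (m ^+ 2 - 4)) / 2.

Lemma mu_spec m : 2 <= m ->
  [/\ 1 <= mu m, mu m + (mu m)^-1 = m & mu m - (mu m)^-1 = Num.sqrt (m ^+ 2 - 4)].
Proof.
move=> m2; rewrite /mu; set s := Num.sqrt _.
have s0 : 0 <= s by exact: sqrtr_ge0.
have s2 : s ^+ 2 = m ^+ 2 - 4 by rewrite sqr_sqrtr // subr_ge0; nra.
have iE : ((m + s) / 2)^-1 = (m - s) / 2.
  apply: (@mulfI _ ((m + s) / 2)); first by rewrite lt0r_neq0 //; lra.
  rewrite divff; last by rewrite lt0r_neq0 //; lra.
  by transitivity ((m ^+ 2 - s ^+ 2) / 4); [rewrite s2; field | field].
by rewrite iE; split; [lra | field | field].
Qed.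

Lemma mu_ge1 m : 2 <= m -> 1 <= mu m.
Proof. by case/mu_spec. Qed.

Lemma mu_gt0 m : 2 <= m -> 0 < mu m.
Proof. by move/mu_ge1; exact: lt_le_trans. Qed.

Lemma mu_sum m : 2 <= m -> mu m + (mu m)^-1 = m.
Proof. by case/mu_spec. Qed.

Lemma mu_diff m : 2 <= m -> mu m - (mu m)^-1 = Num.sqrt (m ^+ 2 - 4).
Proof. by case/mu_spec. Qed.

Lemma mu_gt1 m : 2 < m -> 1 < mu m.
Proof.
move=> m2; rewrite lt_neqAle mu_ge1 ?ltW // andbT; apply/eqP => e.
by have := mu_sum (ltW m2); rewrite -e invr1; lra.
Qed.

Lemma mu_bounds m : 2 <= m -> m - 1 <= mu m <= m.
Proof.
move=> m2; have := mu_sum m2; have := mu_ge1 m2; have := mu_gt0 m2.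
set x := mu m => x0 x1 e.
have : 0 < x^-1 by rewrite invr_gt0.
have : x^-1 <= 1 by rewrite invf_le1.
by move=> *; apply/andP; split; lra.
Qed.

Lemma mu2 : mu 2 = 1.
Proof.
have h : 2 ^+ 2 - 4 = 0 :> R by ring.
by rewrite /mu h sqrtr0; field.
Qed.

Lemma cosh_ln_mu m : 2 <= m -> 2 * cosh (ln (mu m)) = m.
Proof.
move=> m2; rewrite /cosh expRN lnK ?posrE ?mu_gt0 // mulrC divfK // mu_sum //.
Qed.

(* The sequence m_n = A k^n + B k^-n with k = mu q, m_0 = y and m_1 = p has
   A = growth q y p. *)
Definition growth (q y p : R) : R := (p - y / mu q) / (mu q - (mu q)^-1).

Definition disc3 (q y p : R) : R := q ^+ 2 + y ^+ 2 + p ^+ 2 - q * y * p.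

Lemma mu_subV_gt0 q : 2 < q -> 0 < mu q - (mu q)^-1.
Proof.
move=> q2; have := mu_gt1 q2 => k1.
by rewrite subr_gt0 (lt_trans _ k1) // invf_lt1 // (lt_trans _ k1).
Qed.

Lemma growthE q y p : 2 < q ->
  growth q y p * (mu q - (mu q)^-1) = p - y / mu q.
Proof. by move=> q2; rewrite /growth divfK // gt_eqF // mu_subV_gt0. Qed.

(** Shifting the sequence by one index multiplies the coefficient of k^n by k. *)
Lemma growth_iter q y p : 2 < q ->
  growth q p (q * p - y) = mu q * growth q y p.
Proof.
move=> q2; have k0 := mu_gt0 (ltW q2).
have d0 : mu q - (mu q)^-1 != 0 by rewrite gt_eqF // mu_subV_gt0.
apply: (mulIf d0); rewrite -[RHS]mulrA !growthE // mulrBr.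
by rewrite -[X in X * p](mu_sum (ltW q2)); field; rewrite gt_eqF.
Qed.

(** Running the sequence backwards from m_{-1} = x exchanges A and B = [y - growth q y p]; the shift
    by one index contributes the factor [mu q]. *)
Lemma growth_flip q x y p : 2 < q -> x = q * y - p ->
  growth q x (q * x - y) = mu q * (y - growth q y p).
Proof.
move=> q2 xE; have k0 := mu_gt0 (ltW q2).
have d0 : mu q - (mu q)^-1 != 0 by rewrite gt_eqF // mu_subV_gt0.
apply: (mulIf d0); rewrite -[RHS]mulrA [(y - _) * _]mulrBl !growthE // xE.
have -> : q * (q * y - p) = (mu q + (mu q)^-1) * ((mu q + (mu q)^-1) * y - p).
  by rewrite mu_sum ?ltW.
have -> : (q * y - p) / mu q = ((mu q + (mu q)^-1) * y - p) / mu q.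
  by rewrite mu_sum ?ltW.
by field; rewrite gt_eqF.
Qed.

Lemma growth_mul q y p : 2 < q ->
  growth q y p * (y - growth q y p) = 1 + (4 - disc3 q y p) / (q ^+ 2 - 4).
Proof.
move=> q2; have q0 : q ^+ 2 - 4 != 0 by rewrite gt_eqF // subr_gt0; nra.
have d2 : (mu q - (mu q)^-1) ^+ 2 = q ^+ 2 - 4.
  by rewrite mu_diff ?ltW // sqr_sqrtr // subr_ge0; nra.
apply: (mulIf q0); rewrite mulrDl divfK // mul1r -{1}d2.
have -> : growth q y p * (y - growth q y p) * (mu q - (mu q)^-1) ^+ 2
  = (growth q y p * (mu q - (mu q)^-1)) *
    (y * (mu q - (mu q)^-1) - growth q y p * (mu q - (mu q)^-1)) by ring.
rewrite growthE // /disc3.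
have k0 := mu_gt0 (ltW q2).
by rewrite -[X in X * y * p](mu_sum (ltW q2)); field; rewrite gt_eqF.
Qed.

(* growth q y p is a root of x ^ 2 - y x + P with P given by growth_mul, and
   mu y one of x ^ 2 - y x + 1: this is how the sign of 4 - disc3 orders them. *)
Lemma growth_mu q y p : 2 < q -> 2 <= y ->
  (growth q y p - mu y) * (growth q y p - (mu y)^-1)
    = - (4 - disc3 q y p) / (q ^+ 2 - 4).
Proof.
move=> q2 y2.
have -> : - (4 - disc3 q y p) / (q ^+ 2 - 4) = 1 - growth q y p * (y - growth q y p).
  by rewrite growth_mul //; ring.
rewrite -[X in X - growth _ _ _](mu_sum y2).
by field; rewrite gt_eqF // mu_gt0.
Qed.

(** For D < 4 the product in [growth_mu] is negative, so A lies between [(mu y)^-1] and [mu y]. *)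
Lemma growth_elliptic q y p : 2 < q -> 2 <= y -> 2 <= p -> disc3 q y p < 4 ->
  0 < growth q y p <= mu y.
Proof.
move=> q2 y2 p2 D4; have k0 := mu_gt0 (ltW q2); have k1 := mu_gt1 q2.
have qq : 0 < q ^+ 2 - 4 by rewrite subr_gt0; nra.
have c0 : 0 < (4 - disc3 q y p) / (q ^+ 2 - 4) by rewrite divr_gt0 // subr_gt0.
have := growth_mul y p q2; have := growth_mu p q2 y2.
have m1 := mu_ge1 y2; have m0 := mu_gt0 y2.
have i1 : (mu y)^-1 <= 1 by rewrite invf_le1.
rewrite mulNr.
set g := growth q y p; set c := _ / _ in c0 *; move=> e1 e2.
by apply/andP; split; nra.
Qed.

(** Since p - q y / 2 = (A - B) (k - 1/k) / 2 with k = [mu q], direction away from the root makes A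
    the larger of the two coefficients, whose sum is y. *)
Lemma growth_directed q y p : 2 < q -> q * y < 2 * p -> y / 2 < growth q y p.
Proof.
move=> q2 h; have d := mu_subV_gt0 q2.
rewrite -(ltr_pM2r d) growthE //.
by move: h; rewrite -[X in X * y](mu_sum (ltW q2)); lra.
Qed.

(** For D > 4 the product in [growth_mu] is positive, so A is outside the interval from [(mu y)^-1]
    to [mu y]; being above its midpoint y / 2, it is to the right. *)
Lemma growth_hyperbolic q y p : 2 < q -> 2 <= y -> q * y < 2 * p ->
  4 < disc3 q y p -> mu y < growth q y p.
Proof.
move=> q2 y2 h D4; have := growth_directed q2 h.
have qq : 0 < q ^+ 2 - 4 by rewrite subr_gt0; nra.
have c0 : 0 < - (4 - disc3 q y p) / (q ^+ 2 - 4) by rewrite divr_gt0 // oppr_gt0 subr_lt0.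
have := growth_mu p q2 y2.
have m1 := mu_ge1 y2; have := mu_sum y2.
have i1 : (mu y)^-1 <= 1 by rewrite invf_le1 // (lt_le_trans _ m1).
set g := growth q y p; set c := _ / _ in c0 *; move=> e1 e2 e3.
rewrite ltNge; apply/negP => gm.
have : (g - mu y) * (g - (mu y)^-1) <= 0 by rewrite mulr_le0_ge0 //; lra.
by rewrite e2; lra.
Qed.

(** Dividing [growth_mu] by its second factor, which exceeds half of [mu y - (mu y)^-1] because A >
    y / 2, bounds the distance from A to [mu y]; and ln is 1-Lipschitz on (1, oo). *)
Lemma ln_growth_close q y p : 2 < q -> 2 < y -> q * y < 2 * p ->
  `|ln (mu y) - ln (growth q y p)|
    <= 4 * `|4 - disc3 q y p| / ((q ^+ 2 - 4) * Num.sqrt (y ^+ 2 - 4)).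
Proof.
move=> q2 y2 h; have gd := growth_directed q2 h.
have y2' := ltW y2.
have qq : 0 < q ^+ 2 - 4 by rewrite subr_gt0; nra.
have yy : 0 < y ^+ 2 - 4 by rewrite subr_gt0; nra.
have m1 := mu_gt1 y2; have ms := mu_sum y2'; have md := mu_diff y2'.
have s0 : 0 < Num.sqrt (y ^+ 2 - 4) by rewrite sqrtr_gt0.
have i1 : (mu y)^-1 <= 1 by rewrite invf_le1 ?(lt_trans _ m1) // ltW.
have g1 : 1 < growth q y p by lra.
have e := growth_mu p q2 y2'.
set g := growth q y p in g1 gd e *; set s := Num.sqrt _ in md s0 *.
have lnB (a b : R) : 1 < a -> 1 < b -> ln a - ln b <= `|a - b|.
  move=> a1 b1; have a0 : 0 < a by lra.
  have b0 : 0 < b by lra.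
  rewrite -ln_div ?posrE //.
  have -> : a / b = 1 + (a - b) / b by field; rewrite gt_eqF.
  apply: (@le_trans _ _ ((a - b) / b)).
    apply: le_ln1Dx; rewrite ltr_pdivlMr //; lra.
  rewrite ler_pdivrMr //; apply: (le_trans (ler_norm _)).
  by rewrite ler_peMr // ltW.
have h1 : `|ln (mu y) - ln g| <= `|g - mu y|.
  rewrite ler_norml; apply/andP; split.
    by have := lnB _ _ g1 m1; lra.
  by have := lnB _ _ m1 g1; rewrite distrC.
apply: (le_trans h1).
have sg : s / 2 < g - (mu y)^-1 by lra.
have -> : `|g - mu y| = `|4 - disc3 q y p| / (q ^+ 2 - 4) / (g - (mu y)^-1).
  have gp : 0 < g - (mu y)^-1 by lra.
  apply: (canRL (mulfK _)); first by rewrite gt_eqF.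
  by rewrite -[X in _ * X](gtr0_norm gp) -normrM e normrM normrN normfV (gtr0_norm qq).
have -> : 4 * `|4 - disc3 q y p| / ((q ^+ 2 - 4) * s) = `|4 - disc3 q y p| / (q ^+ 2 - 4) * (4 / s).
  by field; rewrite !gt_eqF.
apply: ler_wpM2l; first by rewrite divr_ge0 // ltW.
have h2 : (g - (mu y)^-1)^-1 <= (s / 2)^-1 by rewrite lef_pV2 ?posrE; lra.
apply: (le_trans h2).
by rewrite invf_div ler_pM2r ?invr_gt0 //; lra.
Qed.

End HyperbolicEigenvalue.

(** * One-sided slopes at rational numbers *)

Definition slope (R : realType) (h : rat -> R) (x y : rat) : R :=
  (h y - h x) / (ratr y - ratr x).

(** The slope on [x, z] is a weighted mean of the slopes on [x, y] and [y, z]. *)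
Lemma slope_trans (R : realType) (h : rat -> R) (x y z : rat) : x < y -> y < z ->
  slope h x y <= slope h y z ->
  slope h x y <= slope h x z /\ slope h x z <= slope h y z.
Proof.
rewrite -(ltr_rat R) -[y < z](ltr_rat R) /slope => xy yz.
have xz := lt_trans xy yz.
rewrite ler_pdivrMr ?subr_gt0 // mulrAC ler_pdivlMr ?subr_gt0 // => hh.
by split; rewrite ler_pdivrMr ?subr_gt0 // mulrAC ler_pdivlMr ?subr_gt0 //; lra.
Qed.

Section LengthFunction.
Variables (R : realType) (T : rat -> R) (D : R).
Hypothesis T_rec : forall b q y, farey_adjacent b q y ->
  T (mediant q (mediant q y)) = T q * T (mediant q y) - T y.
Hypothesis T_disc : forall b q y, farey_adjacent b q y ->
  disc3 (T q) (T y) (T (mediant q y)) = D.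
Hypothesis T_ge2 : forall q : rat, 0 <= q <= 1 -> 2 <= T q.
Hypothesis T_gt2 : forall q : rat, 0 < q < 1 -> 2 < T q.
Hypothesis T_dir : 4 <= D -> forall b q y, farey_adjacent b q y ->
  T q * T y < 2 * T (mediant q y).
Hypothesis T_dir_deep : exists N : nat, forall b q y, farey_adjacent b q y ->
  N%:Z <= denq q + denq y -> T q * T y < 2 * T (mediant q y).

Definition len q : R := ln (mu (T q)).
Definition sgD : R := Num.sg (4 - D).
(* The sign of 4 - D makes nlen strictly convex in both cases D < 4, D > 4. *)
Definition nlen q : R := sgD * len q / den R q.
Definition gr q y : R := growth (T q) (T y) (T (mediant q y)).

(* The one-sided slope of nlen at q towards y: the labels at the mediants of
   q with y, iterated n times, grow like gr q y * mu (T q) ^ n. *)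
Definition rho q y : R :=
  (fdet q y)%:~R * (sgD * (den R q * ln (gr q y) - den R y * len q)).

(** The neighbour is an arbitrary choice, with 0 as default if there is none; [side_slopeE] removes
    the dependence on it. *)
Definition side_slope b q : R := rho q (xget 0 [set y | farey_adjacent b q y]).

Hypothesis D4 : D != 4.

Lemma adjacent_ge2 b q y : farey_adjacent b q y ->
  [/\ 2 <= T q, 2 <= T y & 2 <= T (mediant q y)].
Proof.
move=> a; have [q0 q1 y0 y1] := adjacent_bounds a.
have [_ _ p0 p1] := adjacent_bounds (adjacent_mediant a).
by split; apply: T_ge2; apply/andP.
Qed.

Lemma gr_bounds b q y : farey_adjacent b q y -> 2 < T q ->
  0 < gr q y /\ 0 <= sgD * (len y - ln (gr q y)).
Proof.
move=> a Tq; have [_ Ty Tp] := adjacent_ge2 a; have Td := T_disc a.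
rewrite /gr /len /sgD; have [D4'|D4'|D4'] := ltgtP D 4; last by move: D4; rewrite D4' eqxx.
- have /andP[g0 g1] : 0 < growth (T q) (T y) (T (mediant q y)) <= mu (T y).
    by apply: growth_elliptic; rewrite ?Td.
  by rewrite gtr0_sg ?subr_gt0 // mul1r subr_ge0 ler_ln // posrE mu_gt0.
- have g1 : mu (T y) < growth (T q) (T y) (T (mediant q y)).
    by apply: growth_hyperbolic; rewrite ?Td //; apply: T_dir a; exact: ltW.
  have m0 := mu_gt0 Ty; have g0 := lt_trans m0 g1.
  split=> //; rewrite ltr0_sg ?subr_lt0 // mulN1r opprB subr_ge0.
  by rewrite ler_ln // ltW.
Qed.

Lemma fdet_mediant b q y : farey_adjacent b q y -> fdet q (mediant q y) = fdet q y.
Proof. by move=> a; rewrite (adjacent_det a); exact: adjacent_det (adjacent_mediant a). Qed.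

Lemma den_mediant b q y : farey_adjacent b q y ->
  den R (mediant q y) = den R q + den R y.
Proof. by move=> a; rewrite /den; have [_ ->] := adjacent_numden a; rewrite rmorphD. Qed.

(** [gr] gains the factor [mu (T q)], so its logarithm gains [len q]; this cancels against the
    [den R q] added to the denominator of [y]. *)
Lemma rho_mediant b q y : farey_adjacent b q y -> 2 < T q ->
  rho q (mediant q y) = rho q y.
Proof.
move=> a Tq; have [g0 _] := gr_bounds a Tq.
rewrite /rho (fdet_mediant a) (den_mediant a).
have -> : gr q (mediant q y) = mu (T q) * gr q y.
  by rewrite /gr (T_rec a) growth_iter.
rewrite lnM ?posrE // ?mu_gt0 ?ltW // -/(len q).
by congr (_ * (_ * _)); ring.
Qed.

Lemma side_slopeE b q y : farey_adjacent b q y -> 2 < T q ->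
  side_slope b q = rho q y.
Proof.
move=> a Tq; rewrite /side_slope; case: xgetP => [z _ az|/(_ y)//].
apply: (adjacent_ind_side (b := b) (q := q) (P := fun y z => rho q y = rho q z)) => //.
  by move=> x y' z' -> ->.
by move=> y' ay'; rewrite (rho_mediant ay').
Qed.

Lemma slope_adjacent b q y : farey_adjacent b q y ->
  slope nlen q y = (fdet q y)%:~R * (sgD * (den R q * len y - den R y * len q)).
Proof.
move=> a; rewrite /slope (adjacent_ratr R a) (adjacent_det a) rmorphXn rmorphN1 /nlen.
have := den_gt0 R q; have := den_gt0 R y => y0 q0.
by case: b a => a /=; rewrite ?expr0 ?expr1; field; rewrite !gt_eqF.
Qed.

Lemma slopeC (h : rat -> R) x y : slope h x y = slope h y x.
Proof. by rewrite /slope -(opprB (h x)) -(opprB (ratr x)) invrN mulrNN. Qed.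

Lemma slope_sub_rho b q y : farey_adjacent b q y ->
  slope nlen q y - rho q y
  = (fdet q y)%:~R * (den R q * (sgD * (len y - ln (gr q y)))).
Proof. by move=> a; rewrite (slope_adjacent a) /rho; ring. Qed.

(** By [slope_sub_rho], chord slope minus one-sided slope is the determinant times a nonnegative
    number, and the determinant is 1 to the right, -1 to the left. *)
Lemma side_slope_farey x y : farey_neighbours x y ->
  (2 < T x -> side_slope true x <= slope nlen x y) /\
  (2 < T y -> slope nlen x y <= side_slope false y).
Proof.
move=> f; split=> T2.
- have a : farey_adjacent true x y by [].
  rewrite (side_slopeE a T2) -subr_ge0 (slope_sub_rho a) (adjacent_det a) mul1r.
  by have [_ h] := gr_bounds a T2; rewrite mulr_ge0 // ltW // den_gt0.
- have a : farey_adjacent false y x by [].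
  rewrite (side_slopeE a T2) slopeC -subr_le0 (slope_sub_rho a) (adjacent_det a).
  have [_ h] := gr_bounds a T2.
  by rewrite rmorphN1 mulN1r oppr_le0 mulr_ge0 // ltW // den_gt0.
Qed.

(** By [growth_flip] the growths at [q] towards its parents are A and [mu (T q)] times B, so right
    slope minus left slope is [den R q] times the signed ln (A B); A B > 1 if D < 4 and A B < 1 if D
    > 4. *)
Lemma side_slope_lt q : 0 < q < 1 -> side_slope false q < side_slope true q.
Proof.
move=> q01; have Tq := T_gt2 q01; have [x [y [f qE]]] := farey_parents q01.
have ax : farey_adjacent false q x by rewrite qE; exact: farey_mediantl.
have ay : farey_adjacent true q y by rewrite qE; exact: farey_mediantr.
rewrite (side_slopeE ax Tq) (side_slopeE ay Tq) /rho (adjacent_det ax) (adjacent_det ay).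
(* The labels at [x], [y] and [mediant q y] are consecutive terms of the recurrence at [q]. *)
have Tx : T x = T q * T y - T (mediant q y).
  have axy : farey_adjacent false y x by [].
  by have := T_rec axy; rewrite -[mediant y x]mediantC -qE [mediant y q]mediantC mulrC => ->; ring.
have Tqx : T (mediant q x) = T q * T x - T y.
  have axy : farey_adjacent true x y by [].
  by have := T_rec axy; rewrite -qE [mediant x q]mediantC mulrC => ->.
have gx : gr q x = mu (T q) * (T y - gr q y).
  by rewrite /gr Tqx; exact: growth_flip.
have [gx0 _] := gr_bounds ax Tq; have [gy0 _] := gr_bounds ay Tq.
have m0 := mu_gt0 (ltW Tq).
have gy1 : 0 < T y - gr q y by move: gx0; rewrite gx pmulr_rgt0.
have dq : den R q = den R x + den R y.
  by rewrite {1}qE; exact: (@den_mediant true).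
have P := growth_mul (T y) (T (mediant q y)) Tq.
rewrite (T_disc ay) -/(gr q y) in P.
have qq : 0 < T q ^+ 2 - 4 by rewrite subr_gt0; nra.
have lnP : 0 < sgD * ln (gr q y * (T y - gr q y)).
  rewrite P /sgD; set c := _ / _ in P *.
  have P0 : 0 < 1 + c by rewrite -P mulr_gt0.
  have [D4'|D4'|D4'] := ltgtP D 4; last by move: D4; rewrite D4' eqxx.
    rewrite gtr0_sg ?subr_gt0 // mul1r ln_gt0 // ltrDl.
    by rewrite divr_gt0 // subr_gt0.
  rewrite ltr0_sg ?subr_lt0 // mulN1r oppr_gt0 ln_lt0 // P0 /= gtrDl.
  by rewrite pmulr_llt0 ?invr_gt0 // subr_lt0.
rewrite lnM ?posrE // in lnP.
rewrite gx lnM ?posrE // -/(len q) rmorphN1 mulN1r mul1r dq.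
have d0 := den_gt0 R q; rewrite dq in d0.
rewrite -subr_gt0; have := mulr_gt0 d0 lnP.
by congr (0 < _); ring.
Qed.

(** Where two intervals meet, the left slope is below the right slope, so chord slopes increase and
    the bounds pass to the union; [farey_chain] does the rest. *)
Lemma side_slope_bounds x u : 0 <= x -> x < u -> u <= 1 ->
  (2 < T x -> side_slope true x <= slope nlen x u) /\
  (2 < T u -> slope nlen x u <= side_slope false u).
Proof.
move: x u; apply: farey_chain => [|x y z x0 xy yz z1 [hx hy1] [hy2 hz]].
  exact: side_slope_farey.
have y01 : 0 < y < 1 by rewrite (le_lt_trans x0) // (lt_le_trans yz).
have Ty := T_gt2 y01; have lr := side_slope_lt y01.
have h : slope nlen x y <= slope nlen y z.
  by rewrite (le_trans (hy1 Ty)) // (le_trans (ltW lr)) // hy2.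
have [h1 h2] := slope_trans xy yz h.
by split=> [/hx|/hz] h3; [exact: le_trans h1 | exact: le_trans h3].
Qed.

Lemma den_ge2_interior x : 0 <= x <= 1 -> 2 <= denq x -> 0 < x < 1.
Proof.
move=> /andP[x0 x1] d2; rewrite !lt_neqAle x0 x1 !andbT; apply/andP; split.
  by apply: contraTneq d2 => <-.
by apply: contraTneq d2 => ->.
Qed.

(* When m_p > m_q m_y / 2, the numbers m / 2 are supermultiplicative under
   mediants, and (1 + a) (1 + b) >= 1 + a + b. *)
Lemma linear_growth (N : nat) (c : R) x0 y0 u : 0 <= c ->
  (forall b q y, farey_adjacent b q y -> N%:Z <= denq q + denq y ->
    T q * T y < 2 * T (mediant q y)) ->
  farey_neighbours x0 y0 -> x0 <= u <= y0 -> N%:Z <= denq x0 + denq y0 ->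
  2 + 2 * c * den R x0 <= T x0 -> 2 + 2 * c * den R y0 <= T y0 ->
  2 + 2 * c * den R u <= T u.
Proof.
move=> c0 dir f /andP[]; rewrite le_eqVlt => /orP[/eqP->//|xu].
rewrite le_eqVlt => /orP[/eqP->//|uy]; have {xu uy} : x0 < u < y0 by rewrite xu.
have med x y : farey_neighbours x y -> N%:Z <= denq x + denq y ->
    2 + 2 * c * den R x <= T x -> 2 + 2 * c * den R y <= T y ->
    2 + 2 * c * den R (mediant x y) <= T (mediant x y) /\
    N%:Z <= denq (mediant x y).
  move=> {}f Nxy hx hy; have a : farey_adjacent true x y by [].
  have := dir _ _ _ a Nxy; rewrite (den_mediant a).
  have [_ ->] := numden_mediant f; split=> //.
  have hx0 : 0 <= c * den R x by rewrite mulr_ge0 // ltW // den_gt0.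
  have hy0 : 0 <= c * den R y by rewrite mulr_ge0 // ltW // den_gt0.
  have : (2 + 2 * c * den R x) * (2 + 2 * c * den R y) <= T x * T y.
    by apply: ler_pM => //; lra.
  by have := mulr_ge0 hx0 hy0; lra.
move: x0 y0 u f; apply: (farey_descent (P := fun x y u => N%:Z <= denq x + denq y ->
  2 + 2 * c * den R x <= T x -> 2 + 2 * c * den R y <= T y ->
  2 + 2 * c * den R u <= T u)).
- by move=> x y f Nxy hx hy; have [] := med x y f Nxy hx hy.
- move=> x y u f _ IH Nxy hx hy; have [hm Nm] := med x y f Nxy hx hy.
  by apply: IH => //; have := denq_gt0 x; lia.
- move=> x y u f _ IH Nxy hx hy; have [hm Nm] := med x y f Nxy hx hy.
  by apply: IH => //; have := denq_gt0 y; lia.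
Qed.

(* The error decays exponentially with the labels, which here grow at least
   linearly with the denominators; a linear rate is enough. *)
Lemma tangent_gap b q y (c : R) : farey_adjacent b q y -> 0 < c ->
  T q * T y < 2 * T (mediant q y) ->
  2 + 2 * c * den R q <= T q -> 2 + 2 * c * den R y <= T y ->
  `|slope nlen q y - side_slope b q| <= `|4 - D| / (2 * c ^+ 3) / den R q.
Proof.
move=> a c0 dir hq hy.
have q1 := den_ge1 R q; have y1 := den_ge1 R y; have q0 := den_gt0 R q.
have Tq : 2 < T q by apply: lt_le_trans hq; nra.
have Ty : 2 < T y by apply: lt_le_trans hy; nra.
rewrite (side_slopeE a Tq) (slope_sub_rho a) (adjacent_det a) rmorphXn rmorphN1.
rewrite !normrM normrX normrN1 expr1n mul1r (gtr0_norm q0).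
have -> : `|sgD| = 1 by rewrite normr_sg subr_eq0 eq_sym D4.
rewrite mul1r; have := ln_growth_close Tq Ty dir; rewrite (T_disc a) -/(gr q y) -/(len y) => h.
apply: (le_trans (ler_wpM2l (ltW q0) h)).
have s1 : 2 * c <= Num.sqrt (T y ^+ 2 - 4).
  have c2 : 0 <= 2 * c by rewrite mulr_ge0 // ltW.
  have h2 : 2 + 2 * c <= T y by apply: le_trans hy; nra.
  rewrite -(ger0_norm c2) -sqrtr_sqr ler_wsqrtr // lerBrDr.
  apply: le_trans (_ : (2 + 2 * c) ^+ 2 <= _); first by lra.
  by rewrite ler_sqr ?nnegrE //; lra.
have s2 : (2 * c * den R q) ^+ 2 <= T q ^+ 2 - 4.
  have h2 := mulr_gt0 c0 q0.
  rewrite lerBrDr; apply: le_trans (_ : (2 + 2 * c * den R q) ^+ 2 <= _); first by lra.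
  by rewrite ler_sqr ?nnegrE //; lra.
set K := `|_|; have K0 : 0 <= K by exact: normr_ge0.
have e : K / (2 * c ^+ 3) / den R q
   = den R q * (4 * K / ((2 * c * den R q) ^+ 2 * (2 * c))).
  by field; rewrite !gt_eqF.
rewrite e; apply: ler_wpM2l; first exact: ltW.
apply: ler_wpM2l; first by rewrite mulr_ge0.
have p0 : 0 < (2 * c * den R q) ^+ 2 by rewrite exprn_gt0 // !mulr_gt0.
have c2 : 0 < 2 * c by rewrite mulr_gt0.
have w : (2 * c * den R q) ^+ 2 * (2 * c) <= (T q ^+ 2 - 4) * Num.sqrt (T y ^+ 2 - 4).
  by apply: ler_pM => //; exact: ltW.
by rewrite lef_pV2 ?posrE //; [apply: lt_le_trans w|]; rewrite mulr_gt0.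
Qed.

(** One Farey interval around [xi] fixes a growth rate [c]; in a much smaller one, [tangent_gap]
    puts both side slopes close to the slope of the chord. *)
Lemma irrational_gap (xi e : R) : 0 < xi < 1 -> irrational xi -> 0 < e ->
  exists x y, [/\ 0 < x, y < 1, ratr x < xi < ratr y &
    side_slope false y - side_slope true x < e].
Proof.
move=> xi01 irr e0; have [N dir] := T_dir_deep.
(* Depth [N] makes all edges from here on directed away; denominators at least 2 keep both ends
   interior, with labels above 2. *)
have [x0 [y0 [f0 br0 hx0 hy0]]] := farey_approximation (N + 2) xi01 irr.
have [bx0 bx1 by0 by1] := farey_bounds f0.
have Tx0 : 2 < T x0 by apply: T_gt2; apply: den_ge2_interior; [rewrite bx0 | clear - hx0; lia].
have Ty0 : 2 < T y0 by apply: T_gt2; apply: den_ge2_interior; [rewrite by0 | clear - hy0; lia].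
have dx0 := den_gt0 R x0; have dy0 := den_gt0 R y0.
(* The largest [c] with which [linear_growth] can start from [x0] and [y0]. *)
pose c := Num.min ((T x0 - 2) / (2 * den R x0)) ((T y0 - 2) / (2 * den R y0)).
have c0 : 0 < c by rewrite lt_min !divr_gt0 ?subr_gt0 // mulr_gt0.
have cx : 2 + 2 * c * den R x0 <= T x0.
  have : c <= (T x0 - 2) / (2 * den R x0) by rewrite ge_min lexx.
  by rewrite ler_pdivlMr ?mulr_gt0 //; lra.
have cy : 2 + 2 * c * den R y0 <= T y0.
  have : c <= (T y0 - 2) / (2 * den R y0) by rewrite ge_min lexx orbT.
  by rewrite ler_pdivlMr ?mulr_gt0 //; lra.
have N0 : N%:Z <= denq x0 + denq y0 by clear - hx0 hy0; lia.
pose K := `|4 - D| / (2 * c ^+ 3).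
have K0 : 0 <= K by rewrite divr_ge0 // mulr_ge0 // exprn_ge0 // ltW.
(* The first summand makes both errors smaller than e / 2. The second nests [x, y] in [x0, y0]: an
   end of the latter strictly inside (x, y) would have denominator at least [denq x + denq y]. *)
pose n := (Num.bound (2 * K / e) + `|(denq x0 + denq y0)%R|)%N.
have [x [y [f br hx hy]]] := farey_approximation n xi01 irr.
have dx0' := denq_gt0 x0; have dy0' := denq_gt0 y0.
have dx' := denq_gt0 x; have dy' := denq_gt0 y.
have x0x : x0 <= x.
  rewrite leNgt; apply/negP => xx0.
  have : x < x0 < y.
    by rewrite xx0 -(ltr_rat R); case/andP: br0 => h _; case/andP: br => _ /(lt_trans h).
  move/(farey_denq_between f) => hb; rewrite /n in hx hy.
  by clear - hx hy dx0' dy0' dx' dy' hb; lia.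
have yy0 : y <= y0.
  rewrite leNgt; apply/negP => xx0.
  have : x < y0 < y.
    by rewrite xx0 andbT -(ltr_rat R); case/andP: br0 => _ h; case/andP: br => /lt_trans/(_ h).
  move/(farey_denq_between f) => hb; rewrite /n in hx hy.
  by clear - hx hy dx0' dy0' dx' dy' hb; lia.
have xy : x < y by case: f.
have gx : 2 + 2 * c * den R x <= T x.
  apply: (linear_growth (ltW c0) dir f0) => //.
  by rewrite x0x (le_trans (ltW xy)).
have gy : 2 + 2 * c * den R y <= T y.
  apply: (linear_growth (ltW c0) dir f0) => //.
  by rewrite yy0 andbT (le_trans x0x (ltW xy)).
have axy : farey_adjacent true x y by [].
have ayx : farey_adjacent false y x by [].
have dirxy : T x * T y < 2 * T (mediant x y).
  by apply: dir axy _; rewrite /n in hx hy; clear - hx hy dx0' dy0' dx' dy' hx0 hy0; lia.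
have h1 := tangent_gap axy c0 dirxy gx gy.
have h2 : `|slope nlen y x - side_slope false y| <= K / den R y.
  by apply: tangent_gap => //; rewrite mulrC mediantC.
have [x00 x1 y00 y1'] := farey_bounds f.
exists x, y; split=> //.
- have /den_ge2_interior : 0 <= x <= 1 by rewrite x00.
  by case/(_ _)/andP => //; rewrite /n in hx; clear - hx dx0' dy0'; lia.
- have /den_ge2_interior : 0 <= y <= 1 by rewrite y00.
  by case/(_ _)/andP => //; rewrite /n in hy; clear - hy dx0' dy0'; lia.
have nb u : n%:Z <= denq u -> K / den R u < e / 2.
  move=> hu; rewrite ltr_pdivrMr ?den_gt0 // -ltr_pdivrMl ?divr_gt0 //.
  have -> : (e / 2)^-1 * K = 2 * K / e by field; rewrite gt_eqF.
  have Ke : 0 <= 2 * K / e by apply: divr_ge0; [exact: mulr_ge0 | exact: ltW].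
  apply: lt_le_trans (archi_boundP Ke) _.
  rewrite /den pmulrn ler_int; apply: le_trans hu.
  by rewrite lez_nat leq_addr.
have := nb x hx; have := nb y hy.
move: h1 h2; rewrite -/K [slope _ y x]slopeC !ler_norml => /andP[_ h1] /andP[h2 _] h3 h4.
by lra.
Qed.

(** At label 2 the recurrence has the double root 1, so the labels form an arithmetic progression;
    its step has square D - 4 by invariance of D, and is positive by direction. *)
Lemma parabolic_labels b v w : farey_adjacent b v w -> T v = 2 ->
  exists2 c, 0 < c /\ 4 < D & forall n, T (iter n (mediant v) w) = T w + c *+ n.
Proof.
move=> a Tv; exists (T (mediant v w) - T w).
  have : (T (mediant v w) - T w) ^+ 2 = D - 4.
    by rewrite -(T_disc a) /disc3 Tv; ring.
  move=> h; have D4' : 4 < D.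
    by rewrite lt_neqAle eq_sym D4 -subr_ge0 -h sqr_ge0.
  by split=> //; have := T_dir (ltW D4') a; rewrite Tv; lra.
suff h n : T (iter n (mediant v) w) = T w + (T (mediant v w) - T w) *+ n
   /\ T (iter n.+1 (mediant v) w) = T w + (T (mediant v w) - T w) *+ n.+1.
  by move=> n; case: (h n).
elim: n => [|n [IH1 IH2]]; first by rewrite /= mulr0n mulr1n; split; ring.
split=> //; have [an _ _] := adjacent_iter n a.
have := T_rec an; rewrite -!iterS IH2 IH1 Tv => ->; rewrite !mulrS; ring.
Qed.

Lemma len_parabolic v : T v = 2 -> len v = 0 /\ nlen v = 0.
Proof. by move=> Tv; rewrite /nlen /len Tv mu2 ln1 mulr0 mul0r. Qed.

(** Since [len v = 0], the chord from [v] to an iterated mediant [u] has slope [den R v * len u] up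
    to sign, and [len u] is unbounded. *)
Lemma parabolic_slope b v w (M : R) : farey_adjacent b v w -> T v = 2 ->
  exists u, [/\ 0 <= u, u <= 1, if b then v < u else u < v &
    M < (-1) ^+ b * slope nlen v u].
Proof.
move=> a Tv; have [c [c0 D4'] Tz] := parabolic_labels a Tv.
have [_ Tw _] := adjacent_ge2 a.
(* Makes the label at [u] exceed the exponential of |M| by more than 1; [mu] is at least the label
   minus 1. *)
pose n := Num.bound (expR `|M| / c); exists (iter n (mediant v) w).
have [an _ _] := adjacent_iter n a; have [_ _ u0 u1] := adjacent_bounds an.
split=> //.
  by case: b {a} an => -[].
rewrite (slope_adjacent an) (adjacent_det an) (len_parabolic Tv).1 mulr0 subr0.
rewrite rmorphXn rmorphN1 /sgD ltr0_sg ?subr_lt0 //.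
set u := iter _ _ _.
have -> : (-1) ^+ b * ((-1) ^+ (~~ b) * (-1 * (den R v * len u))) = den R v * len u.
  by case: (b); rewrite /= ?expr0 ?expr1; ring.
have Tu : expR `|M| < T u - 1.
  rewrite Tz -mulr_natr.
  have h0 : 0 <= expR `|M| / c by rewrite divr_ge0 ?expR_ge0 ?ltW.
  have := archi_boundP h0; rewrite -/n ltr_pdivrMr // mulrC => h; lra.
have e1 : 1 <= expR `|M| by rewrite -expR0 ler_expR.
have T2 : 2 <= T u by lra.
have m1 := mu_bounds T2.
have lM : `|M| < len u.
  rewrite /len -[X in X < _]expRK ltr_ln ?posrE ?expR_gt0 ?mu_gt0 //.
  by case/andP: m1 => m1 _; lra.
apply: (le_lt_trans (ler_norm M)); apply: (lt_le_trans lM).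
by rewrite ler_peMl ?den_ge1 // (le_trans _ (ltW lM)).
Qed.

(** The line through consecutive iterates [z] and [q] has value [(len z - len q) / den R v] at [v];
    this tends to 0, as consecutive terms of an arithmetic progression have ratio tending to 1. *)
Lemma parabolic_tangent b v w (e : R) : farey_adjacent b v w -> T v = 2 -> 0 < e ->
  exists q, 0 < q < 1 /\ - e < nlen q + side_slope true q * (ratr v - ratr q).
Proof.
move=> a Tv e0; have [c [c0 D4'] Tz] := parabolic_labels a Tv.
have [_ Tw _] := adjacent_ge2 a.
(* Chosen so that c + 1, a bound for [mu (T q) - mu (T z)], is below e times [mu (T z)]. *)
pose n := Num.bound ((c + 1) / (e * c)); pose z := iter n (mediant v) w.
have [an _ _] := adjacent_iter n a; rewrite -/z in an.
have [v0 v1 z0 z1] := adjacent_bounds an.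
have bt : if b then v < mediant v z < z else z < mediant v z < v.
  by case: b {a} an => an; [|rewrite mediantC]; exact: mediant_between.
have q01 : 0 < mediant v z < 1.
  case: b {a an} bt => /andP[h1 h2].
    by rewrite (le_lt_trans v0) // (lt_le_trans h2).
  by rewrite (le_lt_trans z0) // (lt_le_trans h2).
exists (mediant v z); split=> //.
set q := mediant v z in bt q01 *.
have Tq := T_gt2 q01.
have am : farey_adjacent b q z.
  by rewrite /q; case: b {a bt} an => an; [|rewrite mediantC];
    [exact: farey_mediantr | exact: farey_mediantl].
have key : - e < nlen q + slope nlen q z * (ratr v - ratr q).
  have lv := (len_parabolic Tv).1.
  have dq : den R q = den R v + den R z by exact: den_mediant an.
  have dv0 := den_gt0 R v; have dz0 := den_gt0 R z.
  have aq := adjacent_mediant an; rewrite -/q in aq.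
  have -> : nlen q + slope nlen q z * (ratr v - ratr q) = (len z - len q) / den R v.
    rewrite (slope_adjacent am) (adjacent_det am) -[ratr v - _]opprB (adjacent_ratr R aq).
    rewrite /nlen /sgD ltr0_sg ?subr_lt0 // dq.
    case: (b); rewrite /= ?expr0 ?expr1; field; rewrite !gt_eqF //; lra.
  rewrite ltr_pdivlMr //.
  apply: (@le_lt_trans _ _ (- e)).
    by have := den_ge1 R v; nra.
  rewrite ltrNl opprB.
  have TzE : T z = T w + c *+ n by rewrite /z Tz.
  have TqE : T q = T z + c by rewrite /q /z -iterS !Tz mulrSr addrA.
  have cn : 0 <= c *+ n by rewrite mulrn_wge0 // ltW.
  have Tz2 : 2 <= T z by lra.
  have [mz1 mz2] := andP (mu_bounds Tz2); have [mq1 mq2] := andP (mu_bounds (ltW Tq)).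
  have mz0 := mu_gt0 Tz2; have mq0 := mu_gt0 (ltW Tq).
  rewrite /len -ln_div ?posrE //.
  have -> : mu (T q) / mu (T z) = 1 + (mu (T q) - mu (T z)) / mu (T z).
    by field; rewrite gt_eqF.
  apply: (@le_lt_trans _ _ ((mu (T q) - mu (T z)) / mu (T z))).
    apply: le_ln1Dx; rewrite ltr_pdivlMr //; lra.
  rewrite ltr_pdivrMr //.
  have h0 : 0 <= (c + 1) / (e * c) by rewrite divr_ge0 ?mulr_ge0 ?addr_ge0 ?ltW.
  have := archi_boundP h0; rewrite -/n ltr_pdivrMr ?mulr_gt0 // => h.
  have : c + 1 < e * (c *+ n) by rewrite -mulr_natr; lra.
  have : e * (c *+ n) <= e * (T z - 1) by rewrite ler_pM2l //; lra.
  have : e * (T z - 1) <= e * mu (T z) by rewrite ler_pM2l //; lra.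
  lra.
apply: (lt_le_trans key); rewrite lerD2l.
(* Replacing the chord slope by the right slope at [q] does not lower the value at [v]: the right
   slope is at most the chord slope if v < q, at least the chord slope if q < v. *)
have lr := side_slope_lt q01.
case: b {a an am} bt => /andP[h1 h2].
  have [_ q1] := andP q01.
  have [h _] := side_slope_bounds (ltW (andP q01).1) h2 z1.
  have vq : ratr v < ratr q :> R by rewrite ltr_rat.
  by rewrite ler_wnM2r ?h // subr_le0 ltW.
have [_ h] := side_slope_bounds z0 h1 (ltW (andP q01).2).
have vq : ratr q < ratr v :> R by rewrite ltr_rat.
apply: ler_wpM2r; first by rewrite subr_ge0 ltW.
by rewrite slopeC (le_trans (h Tq)) // ltW.
Qed.
End LengthFunction.

(** * Convex functions on the unit interval *)

Section Convex.
Variables (R : realType) (G : R -> R).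
Hypothesis G_convex : forall x y t : R, 0 <= x -> x < y -> y <= 1 -> 0 <= t <= 1 ->
  G ((1 - t) * x + t * y) <= (1 - t) * G x + t * G y.

Lemma convex_chord (x y z : R) : 0 <= x -> x < y -> y < z -> z <= 1 ->
  (z - x) * G y <= (z - y) * G x + (y - x) * G z.
Proof.
move=> x0 xy yz z1; have zx : 0 < z - x by lra.
have t01 : 0 <= (y - x) / (z - x) <= 1.
  by rewrite divr_ge0 ?ler_pdivrMr //; lra.
have := G_convex x0 (lt_trans xy yz) z1 t01.
have -> : (1 - (y - x) / (z - x)) * x + (y - x) / (z - x) * z = y.
  by field; rewrite gt_eqF.
rewrite -(ler_pM2l zx) => h; apply: (le_trans h).
rewrite le_eqVlt; apply/orP; left; apply/eqP.
by field; rewrite gt_eqF.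
Qed.

Definition dquot (x h : R) : R := h^-1 * (G (x + h) - G x).

(** [convex_chord] for x, x + h, x + k, in the order that the signs of h and k impose. *)
Lemma dquot_mono (x h k : R) : 0 <= x -> x <= 1 -> 0 <= x + h -> x + k <= 1 ->
  h != 0 -> k != 0 -> h <= k -> dquot x h <= dquot x k.
Proof.
move=> x0 x1 xh xk hn kn; rewrite le_eqVlt => /orP[/eqP->//|hk].
have eh : G (x + h) = G x + h * dquot x h by rewrite /dquot mulVKf //; ring.
have ek : G (x + k) = G x + k * dquot x k by rewrite /dquot mulVKf //; ring.
have [h0|h0|h0] := ltgtP h 0; last by rewrite h0 eqxx in hn.
- have [k0|k0|k0] := ltgtP k 0; last by rewrite k0 eqxx in kn.
  + have := @convex_chord (x + h) (x + k) x xh _ _ x1.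
    rewrite ltrD2l => /(_ hk); rewrite gtrDl => /(_ k0); rewrite eh ek => c.
    by rewrite -(ler_pM2l (_ : 0 < h * k)) ?nmulr_lgt0 //; lra.
  + have := @convex_chord (x + h) x (x + k) xh _ _ xk.
    rewrite gtrDl => /(_ h0); rewrite ltrDl => /(_ k0); rewrite eh ek => c.
    by rewrite -(ler_pM2l (_ : 0 < - h * k)) ?mulr_gt0 ?oppr_gt0 //; lra.
- have k0 := lt_trans h0 hk.
  have := @convex_chord x (x + h) (x + k) x0 _ _ xk.
  rewrite ltrDl => /(_ h0); rewrite ltrD2l => /(_ hk); rewrite eh ek => c.
  by rewrite -(ler_pM2l (_ : 0 < h * k)) ?mulr_gt0 //; lra.
Qed.

(** Difference quotients decrease as h decreases to 0, hence converge to their infimum, which [c]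
    keeps finite. *)
Lemma right_limit (x c : R) : 0 <= x -> x < 1 ->
  (forall h, 0 < h -> x + h <= 1 -> c <= dquot x h) ->
  exists L, [/\ c <= L, forall h, 0 < h -> x + h <= 1 -> L <= dquot x h &
    forall e, 0 < e -> exists2 d, 0 < d & forall h, 0 < h -> h < d -> `|dquot x h - L| < e].
Proof.
move=> x0 x1 hc; pose A := [set dquot x h | h in [set h | 0 < h /\ x + h <= 1]].
have A0 : A !=set0 by exists (dquot x (1 - x)), (1 - x) => //=; split; lra.
have Al : lbound A c by move=> _ [h [h0 h1] <-]; exact: hc.
have iA : has_inf A by split=> //; exists c.
have Li h : 0 < h -> x + h <= 1 -> inf A <= dquot x h.
  by move=> h0 h1; apply: ge_inf; [exists c | exists h].
exists (inf A); split=> //; first exact: lb_le_inf.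
move=> e e0; have [_ [d [d0 d1] <-] dL] := inf_adherent e0 iA.
exists d => // h h0 hd; have hx : x + h <= 1 by lra.
have h1 := Li h h0 hx.
rewrite ger0_norm ?subr_ge0 //.
have h2 : dquot x h <= dquot x d.
  by apply: dquot_mono; [| | | |rewrite gt_eqF|rewrite gt_eqF|]; lra.
lra.
Qed.

Lemma left_limit (x c : R) : 0 < x -> x <= 1 ->
  (forall h, h < 0 -> 0 <= x + h -> dquot x h <= c) ->
  exists L, [/\ L <= c, forall h, h < 0 -> 0 <= x + h -> dquot x h <= L &
    forall e, 0 < e -> exists2 d, 0 < d & forall h, h < 0 -> - d < h -> `|dquot x h - L| < e].
Proof.
move=> x0 x1 hc; pose A := [set dquot x h | h in [set h | h < 0 /\ 0 <= x + h]].
have A0 : A !=set0 by exists (dquot x (- x)), (- x) => //=; split; lra.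
have Al : ubound A c by move=> _ [h [h0 h1] <-]; exact: hc.
have iA : has_sup A by split=> //; exists c.
have Li h : h < 0 -> 0 <= x + h -> dquot x h <= sup A.
  by move=> h0 h1; apply: ub_le_sup; [exists c | exists h].
exists (sup A); split=> //; first exact: ge_sup.
move=> e e0; have [_ [d [d0 d1] <-] dL] := sup_adherent e0 iA.
exists (- d); first by rewrite oppr_gt0.
move=> h h0; rewrite opprK => hd; have hx : 0 <= x + h by lra.
have h1 := Li h h0 hx.
rewrite ler0_norm ?subr_le0 //.
have h2 : dquot x d <= dquot x h.
  by apply: dquot_mono; [| | | |rewrite lt_eqF|rewrite lt_eqF|]; lra.
lra.
Qed.

End Convex.

(** * Derivatives and continuity from epsilon-delta estimates *)

Section OneSidedDerivatives.
Variable R : realType.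
Implicit Types (f : R -> R) (x L : R).

Lemma has_right_derivativeP f x L :
  (forall e, 0 < e -> exists2 d, 0 < d &
     forall h, 0 < h -> h < d -> `|h^-1 * (f (x + h) - f x) - L| < e) ->
  has_right_derivative f x L%:E.
Proof.
move=> H; apply/fine_cvgP; split; first by near=> h.
apply/cvgrPdist_lt => e e0; have [d d0 Hd] := H e e0.
near=> h; rewrite /= distrC; apply: Hd; near: h.
  exact: nbhs_right_gt.
exact: nbhs_right_lt.
Unshelve. all: by end_near. Qed.

Lemma has_left_derivativeP f x L :
  (forall e, 0 < e -> exists2 d, 0 < d &
     forall h, h < 0 -> - d < h -> `|h^-1 * (f (x + h) - f x) - L| < e) ->
  has_left_derivative f x L%:E.
Proof.
move=> H; apply/fine_cvgP; split; first by near=> h.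
apply/cvgrPdist_lt => e e0; have [d d0 Hd] := H e e0.
near=> h; rewrite /= distrC; apply: Hd; near: h.
  exact: nbhs_left_lt.
by apply: nbhs_left_gt; rewrite oppr_lt0.
Unshelve. all: by end_near. Qed.

Lemma has_right_derivativeyP f x :
  (forall M, exists2 d, 0 < d & forall h, 0 < h -> h < d -> M <= h^-1 * (f (x + h) - f x)) ->
  has_right_derivative f x +oo%E.
Proof.
move=> H; apply/cvgeyPge => M; have [d d0 Hd] := H M.
near=> h; rewrite lee_fin; apply: Hd; near: h.
  exact: nbhs_right_gt.
exact: nbhs_right_lt.
Unshelve. all: by end_near. Qed.

Lemma has_left_derivativeNyP f x :
  (forall M, exists2 d, 0 < d & forall h, h < 0 -> - d < h -> h^-1 * (f (x + h) - f x) <= M) ->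
  has_left_derivative f x -oo%E.
Proof.
move=> H; apply/cvgeNyPle => M; have [d d0 Hd] := H M.
near=> h; rewrite lee_fin; apply: Hd; near: h.
  exact: nbhs_left_lt.
by apply: nbhs_left_gt; rewrite oppr_lt0.
Unshelve. all: by end_near. Qed.

Lemma has_right_derivative_unique f x L M :
  has_right_derivative f x L%:E -> has_right_derivative f x M%:E -> L = M.
Proof. by move=> h1 h2; apply: EFin_inj; exact: (cvg_unique _ h1 h2). Qed.

Lemma has_left_derivative_unique f x L M :
  has_left_derivative f x L%:E -> has_left_derivative f x M%:E -> L = M.
Proof. by move=> h1 h2; apply: EFin_inj; exact: (cvg_unique _ h1 h2). Qed.

Lemma derivable_dist f x L :
  (forall e, 0 < e -> exists2 d, 0 < d &
     forall h, h != 0 -> `|h| < d -> `|h^-1 * (f (x + h) - f x) - L| < e) ->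
  derivable f x 1.
Proof.
move=> H; apply/cvg_ex; exists L; apply/cvgrPdist_lt => e e0.
have [d d0 Hd] := H e e0.
near=> h; rewrite /= distrC [_%:A]mulr1 [h + x]addrC; apply: Hd.
  by near: h; exact: nbhs_dnbhs_neq.
by near: h; exact: dnbhs0_lt.
Unshelve. all: by end_near. Qed.

Lemma continuous01_dist f :
  (forall x e, 0 <= x <= 1 -> 0 < e -> exists2 d, 0 < d &
     forall y, 0 <= y <= 1 -> `|y - x| < d -> `|f y - f x| < e) ->
  {within `[0, 1], continuous f}.
Proof.
move=> H; apply/subspace_continuousP => x; rewrite /= in_itv /= => x01.
apply/cvgrPdist_lt => e e0; have [d d0 Hd] := H x e x01 e0.
apply/nbhs_ballP; exists d => //= y; rewrite /ball /= => yx y01.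
by rewrite distrC; apply: Hd; [move: y01; rewrite in_itv | rewrite distrC].
Qed.

End OneSidedDerivatives.

(** * Extension by tangents *)

Lemma rat_between (R : realType) (a b : R) : a < b -> exists q : rat, a < ratr q < b.
Proof. by move=> ab; have [q] := rat_in_itvoo ab; rewrite in_itv /=; exists q. Qed.

Lemma ratr01 (R : realType) (q : rat) : (0 <= (ratr q : R) <= 1) = (0 <= q <= 1).
Proof. by rewrite -[in LHS](rmorph0 (@ratr R)) -(rmorph1 (@ratr R)) !ler_rat. Qed.

Section ConvexExtension.
Variables (R : realType) (g l r : rat -> R) (good : rat -> Prop).
Hypothesis good_interior : forall q : rat, 0 < q < 1 -> good q.
Hypothesis slope_bounds : forall x u : rat, 0 <= x -> x < u -> u <= 1 ->
  (good x -> r x <= slope g x u) /\ (good u -> slope g x u <= l u).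
Hypothesis l_lt_r : forall q : rat, 0 < q < 1 -> l q < r q.
Hypothesis endpoint_tangent : forall (v : rat) (e : R), 0 <= v <= 1 -> ~ good v -> 0 < e ->
  exists q : rat, 0 < q < 1 /\ g v - e < g q + r q * (ratr v - ratr q).

(** At 1 there is no chord to the right, so the left slope takes over. *)
Definition subgradient (q : rat) : R := if q < 1 then r q else l q.
Definition tangent (q : rat) (x : R) : R := g q + subgradient q * (x - ratr q).
Definition tangents (x : R) : set R :=
  [set tangent q x | q in [set q | 0 <= q <= 1 /\ good q]].
(* Only finite slopes occur: at an endpoint with label 2, where the graph of g
   is vertical, endpoint_tangent supplies nearby tangents instead. *)
Definition extension (x : R) : R := sup (tangents x).

(** Chords from [q] to the right have slope at least [r q]; those to the left at most [l q], which
    is below [r q] at interior points. *)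
Lemma tangent_le q p : 0 <= q <= 1 -> good q -> 0 <= p <= 1 -> tangent q (ratr p) <= g p.
Proof.
move=> /andP[q0 q1] gq /andP[p0 p1]; rewrite /tangent.
have [pq|qp|->] := ltgtP p q; last by rewrite subrr mulr0 addr0.
- have [_ /(_ gq) h] := slope_bounds p0 pq q1.
  have pqR : ratr p < ratr q :> R by rewrite ltr_rat.
  have sl : slope g p q <= subgradient q.
    rewrite /subgradient; case: ltP => // q1'; apply: (le_trans h); apply/ltW/l_lt_r.
    by rewrite q1' (le_lt_trans p0).
  have : slope g p q * (ratr q - ratr p) = g q - g p.
    by rewrite /slope divfK // gt_eqF // subr_gt0.
  have pq0 : 0 <= ratr q - ratr p :> R by rewrite subr_ge0 ltW.
  by have := ler_wpM2r pq0 sl; lra.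
- have [/(_ gq) h _] := slope_bounds q0 qp p1.
  have pqR : ratr q < ratr p :> R by rewrite ltr_rat.
  rewrite /subgradient (lt_le_trans qp p1).
  have : slope g q p * (ratr p - ratr q) = g p - g q.
    by rewrite /slope divfK // gt_eqF // subr_gt0.
  have qp0 : 0 <= ratr p - ratr q :> R by rewrite subr_ge0 ltW.
  by have := ler_wpM2r qp0 h; lra.
Qed.

(** Bounds the supremum in [extension]: an affine function below [g] at 0 and 1 is below the
    chord. *)
Lemma tangent_chord q x : 0 <= q <= 1 -> good q -> 0 <= x <= 1 ->
  tangent q x <= (1 - x) * g 0 + x * g 1.
Proof.
move=> q01 gq /andP[x0 x1].
have := tangent_le q01 gq (p := 0) isT; have := tangent_le q01 gq (p := 1) isT.
rewrite /tangent rmorph0 rmorph1 => h1 h0.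
have : (1 - x) * (g q + subgradient q * (0 - ratr q)) <= (1 - x) * g 0.
  by rewrite ler_wpM2l // subr_ge0.
have : x * (g q + subgradient q * (1 - ratr q)) <= x * g 1 by rewrite ler_wpM2l.
lra.
Qed.

Lemma tangents_nonempty x : tangents x !=set0.
Proof.
exists (tangent (1 / 2) x), (1 / 2) => //=.
by split=> //; exact: good_interior.
Qed.

Lemma tangents_ubound x : 0 <= x <= 1 -> ubound (tangents x) ((1 - x) * g 0 + x * g 1).
Proof. by move=> x01 _ [q [q01 gq] <-]; exact: tangent_chord. Qed.

Lemma tangent_le_extension q x : 0 <= x <= 1 -> 0 <= q <= 1 -> good q ->
  tangent q x <= extension x.
Proof.
move=> x01 q01 gq; apply: ub_le_sup; last by exists q.
by exists ((1 - x) * g 0 + x * g 1); exact: tangents_ubound.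
Qed.

Lemma extension_le x M : (forall q, 0 <= q <= 1 -> good q -> tangent q x <= M) ->
  extension x <= M.
Proof.
move=> h; apply: ge_sup; first exact: tangents_nonempty.
by move=> _ [q [q01 gq] <-]; exact: h.
Qed.

Lemma extension_adherent x e : 0 <= x <= 1 -> 0 < e ->
  exists2 q, 0 <= q <= 1 /\ good q & extension x - e < tangent q x.
Proof.
move=> x01 e0.
have sA : has_sup (tangents x).
  split; first exact: tangents_nonempty.
  by exists ((1 - x) * g 0 + x * g 1); exact: tangents_ubound.
by have [_ [q hq <-] h] := sup_adherent e0 sA; exists q.
Qed.

Lemma extension_rat p : 0 <= p <= 1 -> extension (ratr p) = g p.
Proof.
move=> p01; apply/eqP; rewrite eq_le; apply/andP; split.
  by apply: extension_le => q q01 gq; exact: tangent_le.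
have p01R : 0 <= (ratr p : R) <= 1 by rewrite ratr01.
have [gp|ngp] := pselect (good p).
  apply: le_trans (tangent_le_extension p01R p01 gp).
  by rewrite /tangent subrr mulr0 addr0.
apply/ler_addgt0Pr => e e0; have [q [q01 h]] := endpoint_tangent p01 ngp e0.
have gq := good_interior q01; case/andP: q01 => q0 q1.
have q01' : 0 <= q <= 1 by rewrite !ltW.
have := tangent_le_extension p01R q01' gq.
by rewrite /tangent /subgradient q1; lra.
Qed.

(** A supremum of affine functions. *)
Lemma extension_convex x y t : 0 <= x -> x < y -> y <= 1 -> 0 <= t <= 1 ->
  extension ((1 - t) * x + t * y) <= (1 - t) * extension x + t * extension y.
Proof.
move=> x0 xy y1 /andP[t0 t1]; apply: extension_le => q q01 gq.
have hx := @tangent_le_extension q x _ q01 gq; have hy := @tangent_le_extension q y _ q01 gq.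
have {}hx : tangent q x <= extension x by apply: hx; lra.
have {}hy : tangent q y <= extension y by apply: hy; lra.
have -> : tangent q ((1 - t) * x + t * y) = (1 - t) * tangent q x + t * tangent q y.
  by rewrite /tangent; ring.
by apply: lerD; apply: ler_wpM2l => //; lra.
Qed.

Lemma extension_slope_right q u : 0 <= q -> good q -> ratr q < u -> u <= 1 ->
  r q * (u - ratr q) <= extension u - extension (ratr q).
Proof.
move=> q0 gq qu u1.
have q1 : q < 1 by rewrite -(ltr_rat R) rmorph1 (lt_le_trans qu).
have q0R : 0 <= ratr q :> R by rewrite -(rmorph0 (@ratr R)) ler_rat.
have q01 : 0 <= q <= 1 by rewrite q0 ltW.
have u01 : 0 <= u <= 1 by rewrite u1 (le_trans q0R) // ltW.
rewrite (extension_rat q01).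
by have := tangent_le_extension u01 q01 gq; rewrite /tangent /subgradient q1; lra.
Qed.

(** Tangents at interior points carry right slopes, so the left slope enters through a rational p
    between u and q: by convexity the slope on [u, q] is at most that on [p, q]. *)
Lemma extension_slope_left q u : q <= 1 -> good q -> u < ratr q -> 0 <= u ->
  extension (ratr q) - extension u <= l q * (ratr q - u).
Proof.
move=> q1 gq uq u0.
have q0 : 0 < q by rewrite -(ltr_rat R) rmorph0 (le_lt_trans u0).
have q1R : ratr q <= 1 :> R by rewrite -(rmorph1 (@ratr R)) ler_rat.
have [p /andP[up pq]] := rat_between uq.
have p0 : 0 < p by rewrite -(ltr_rat R) rmorph0 (le_lt_trans u0).
have pq' : p < q by rewrite -(ltr_rat R).
have [_ /(_ gq) h] := slope_bounds (ltW p0) pq' q1.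
have e : slope g p q * (ratr q - ratr p) = extension (ratr q) - extension (ratr p).
  rewrite !extension_rat ?(ltW q0) ?(ltW p0) //= ?(le_trans (ltW pq')) //.
  by rewrite /slope divfK // gt_eqF // subr_gt0.
have c := convex_chord extension_convex u0 up pq q1R.
have qp0 : 0 < ratr q - ratr p :> R by rewrite subr_gt0.
have qu0 : 0 < ratr q - u by rewrite subr_gt0.
have h2 := ler_wpM2r (ltW qp0) h.
rewrite -(ler_pM2l qp0).
have h3 := ler_wpM2l (ltW qu0) h2; rewrite e in h3.
by lra.
Qed.

(** A rational [q] between [x] and [z] is a corner, which puts the graph at [q] strictly below the
    chord over [x, y]; convexity on [q, y] passes this on to [z]. *)
Lemma extension_strict x y t : 0 <= x -> x < y -> y <= 1 -> 0 < t < 1 ->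
  extension ((1 - t) * x + t * y) < (1 - t) * extension x + t * extension y.
Proof.
move=> x0 xy y1 /andP[t0 t1]; set z := _ + _.
have xz : x < z by rewrite /z; nra.
have zy : z < y by rewrite /z; nra.
have [q /andP[xq qz]] := rat_between xz.
have q0 : 0 < q by rewrite -(ltr_rat R) rmorph0 (le_lt_trans x0).
have q1 : q < 1 by rewrite -(ltr_rat R) rmorph1 (lt_trans qz) // (lt_le_trans zy).
have q01 : 0 < q < 1 by rewrite q0.
have gq := good_interior q01.
have qy := lt_trans qz zy.
have hx := extension_slope_left (ltW q1) gq xq x0.
have hy := extension_slope_right (ltW q0) gq qy y1.
have lr := l_lt_r q01.
have q0R : 0 <= ratr q :> R by rewrite -(rmorph0 (@ratr R)) ler_rat ltW.
have c := convex_chord extension_convex q0R qz zy y1.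
have strict : (y - x) * extension (ratr q)
    < (y - ratr q) * extension x + (ratr q - x) * extension y.
  have a0 : 0 < ratr q - x by lra.
  have b0 : 0 < y - ratr q by lra.
  have h1 := ler_wpM2l (ltW b0) hx; have h2 := ler_wpM2l (ltW a0) hy.
  have h3 : l q * ((ratr q - x) * (y - ratr q)) < r q * ((ratr q - x) * (y - ratr q)).
    by rewrite ltr_pM2r // mulr_gt0.
  by lra.
have yq : 0 < y - ratr q by lra.
have yz : 0 < y - z by lra.
have yx : 0 < y - x by lra.
suff : (y - x) * extension z < (y - z) * extension x + (z - x) * extension y.
  have -> : y - z = (y - x) * (1 - t) by rewrite /z; ring.
  have -> : z - x = (y - x) * t by rewrite /z; ring.
  by rewrite -!mulrA -mulrDr ltr_pM2l.
rewrite -(ltr_pM2l yq).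
have h1 := ler_wpM2l (ltW yx) c.
have h2 : (y - z) * ((y - x) * extension (ratr q)) <
  (y - z) * ((y - ratr q) * extension x + (ratr q - x) * extension y) by rewrite ltr_pM2l.
by lra.
Qed.

(** The lower bound comes from a tangent nearly touching at [x], the upper one from the chord
    joining [x] to the endpoint on the side of [y]. *)
Lemma extension_continuous x e : 0 <= x <= 1 -> 0 < e -> exists2 d, 0 < d &
  forall y, 0 <= y <= 1 -> `|y - x| < d -> `|extension y - extension x| < e.
Proof.
move=> x01 e0; have e2 : 0 < e / 2 by rewrite divr_gt0.
have [q [q01 gq] h] := extension_adherent x01 e2.
have [x0 x1] := andP x01.
(* At x = 1 the division by zero gives [a] = 0; [a] serves only for x < y, where x < 1. Likewise for
   [b] at x = 0. *)
pose a := `|extension 1 - extension x| / (1 - x).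
pose b := `|extension 0 - extension x| / x.
pose K := `|subgradient q| + a + b + 1.
have a0 : 0 <= a by rewrite divr_ge0 // subr_ge0.
have b0 : 0 <= b by rewrite divr_ge0.
have K0 : 0 < K by rewrite ltr_wpDl // !addr_ge0.
exists (e / 2 / K); first by rewrite divr_gt0.
move=> y y01; have [y0 y1] := andP y01; rewrite ltr_pdivlMr // => yx.
have Kge (c : R) : 0 <= c -> c <= K -> `|y - x| * c < e / 2.
  by move=> c0 cK; apply: le_lt_trans yx; apply: ler_wpM2l.
have lower : extension x - e < extension y.
  have h1 := tangent_le_extension y01 q01 gq.
  have h2 : tangent q y = tangent q x + subgradient q * (y - x) by rewrite /tangent; ring.
  have h3 : - (`|y - x| * `|subgradient q|) <= subgradient q * (y - x).
    by rewrite lerNl mulrC -normrM ler_normr lexx orbT.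
  have := Kge `|subgradient q| (normr_ge0 _); rewrite /K; lra.
have upper : extension y < extension x + e.
  have [xy|xy|->] := ltgtP x y; last by lra.
  - have : extension y - extension x <= `|y - x| * a.
      have x1' : 0 < 1 - x by lra.
      rewrite /a mulrA ler_pdivlMr // (gtr0_norm (_ : 0 < y - x)) ?subr_gt0 //.
      apply: le_trans (_ : (y - x) * (extension 1 - extension x) <= _); last first.
        by rewrite ler_wpM2l ?ler_norm // subr_ge0 ltW.
      move: y1; rewrite le_eqVlt => /orP[/eqP->|y1]; first by lra.
      by have := convex_chord extension_convex x0 xy y1 (lexx 1); lra.
    by have := Kge a a0; rewrite /K; have := normr_ge0 (subgradient q); lra.
  - have : extension y - extension x <= `|y - x| * b.
      have x0' : 0 < x by lra.
      rewrite /b mulrA ler_pdivlMr // (ltr0_norm (_ : y - x < 0)) ?subr_lt0 //.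
      apply: le_trans (_ : (x - y) * (extension 0 - extension x) <= _); last first.
        by rewrite opprB ler_wpM2l ?ler_norm // subr_ge0 ltW.
      move: y0; rewrite le_eqVlt => /orP[/eqP<-|y0]; first by lra.
      by have := convex_chord extension_convex (lexx 0) y0 xy x1; lra.
    by have := Kge b b0; rewrite /K; have := normr_ge0 (subgradient q); lra.
by rewrite ltr_norml; apply/andP; split; lra.
Qed.

(** By monotonicity, difference quotients at [xi] from both sides lie between [r x] and [l y] as
    long as x and y enclose xi + h, and these bounds can be made arbitrarily close. *)
Lemma extension_irrational xi : 0 < xi < 1 ->
  (forall e, 0 < e -> exists x y : rat, [/\ 0 < x, y < 1, ratr x < xi < ratr y & l y - r x < e]) ->
  exists L, forall e, 0 < e -> exists2 d, 0 < d &
    forall h, h != 0 -> `|h| < d -> `|dquot extension xi h - L| < e.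
Proof.
move=> /andP[xi0 xi1] gap.
have dm := dquot_mono extension_convex (ltW xi0) (ltW xi1).
have lower (x : rat) h : 0 < x -> ratr x < xi -> h != 0 -> ratr x <= xi + h -> xi + h <= 1 ->
    r x <= dquot extension xi h.
  move=> x0 xx h0 h1 h2.
  have gx : good x.
    by apply: good_interior; rewrite x0 -(ltr_rat R) rmorph1 (lt_trans xx).
  have x0R : 0 < ratr x :> R by rewrite -(rmorph0 (@ratr R)) ltr_rat.
  have n0 : ratr x - xi < 0 by rewrite subr_lt0.
  apply: (@le_trans _ _ (dquot extension xi (ratr x - xi))).
    have h3 := extension_slope_right (ltW x0) gx xx (ltW xi1).
    rewrite /dquot (_ : xi + (ratr x - xi) = ratr x); last by ring.
    by rewrite -(ler_nM2l n0) mulVKf ?lt_eqF //; lra.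
  by apply: dm => //; [lra | rewrite lt_eqF | lra].
have upper (y : rat) h : y < 1 -> xi < ratr y -> h != 0 -> xi + h <= ratr y -> 0 <= xi + h ->
    dquot extension xi h <= l y.
  move=> y1 xy h0 h1 h2.
  have gy : good y.
    by apply: good_interior; rewrite y1 andbT -(ltr_rat R) rmorph0 (lt_trans xi0).
  have y1R : ratr y < 1 :> R by rewrite -(rmorph1 (@ratr R)) ltr_rat.
  have p0 : 0 < ratr y - xi by rewrite subr_gt0.
  apply: (@le_trans _ _ (dquot extension xi (ratr y - xi))); last first.
    have h3 := extension_slope_left (ltW y1) gy xy (ltW xi0).
    rewrite /dquot (_ : xi + (ratr y - xi) = ratr y); last by ring.
    by rewrite -(ler_pM2l p0) mulVKf ?gt_eqF //; lra.
  by apply: dm => //; [lra | rewrite gt_eqF | lra].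
have [x1 [y1 [x10 y11 /andP[xx1 xy1] _]]] := gap 1 ltr01.
have [L [_ HL HLe]] : exists L, [/\ r x1 <= L,
    forall h, 0 < h -> xi + h <= 1 -> L <= dquot extension xi h &
    forall e, 0 < e -> exists2 d, 0 < d &
      forall h, 0 < h -> h < d -> `|dquot extension xi h - L| < e].
  apply: (right_limit extension_convex) => //; first exact: ltW.
  by move=> h h0 h1; apply: lower => //; [rewrite gt_eqF | lra].
exists L => e e0; have [x [y [x0 y1' br hg]]] := gap e e0.
have [xx xy] := andP br.
pose d := Num.min (xi - ratr x) (ratr y - xi).
have d0 : 0 < d by rewrite lt_min !subr_gt0 xx.
exists d => // h h0; rewrite lt_min => /andP[].
rewrite !ltr_norml => /andP[h1 h2] /andP[h3 h4].
have y1R : ratr y < 1 :> R by rewrite -(rmorph1 (@ratr R)) ltr_rat.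
have x0R : 0 < ratr x :> R by rewrite -(rmorph0 (@ratr R)) ltr_rat.
have b1 : r x <= dquot extension xi h by apply: lower => //; lra.
have b2 : dquot extension xi h <= l y by apply: upper => //; lra.
have Lr : L <= l y.
  have k0 : 0 < ratr y - xi by lra.
  apply: (le_trans (HL _ k0 _)); first lra.
  by apply: upper => //; [rewrite gt_eqF | lra | lra].
(* [L] is the limit of quotients at small k > 0, each at least [r x]. *)
have Ll : r x <= L.
  apply/ler_addgt0Pr => e' e'0; have [d' d'0 Hd] := HLe e' e'0.
  pose k := Num.min d' (1 - xi) / 2.
  have k0 : 0 < k by rewrite divr_gt0 // lt_min d'0 subr_gt0.
  have kd : k < d'.
    have : Num.min d' (1 - xi) <= d' by rewrite ge_min lexx.
    rewrite /k; lra.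
  have ky : k < 1 - xi.
    have : Num.min d' (1 - xi) <= 1 - xi by rewrite ge_min lexx orbT.
    rewrite /k; lra.
  have := Hd k k0 kd; rewrite ltr_norml => /andP[h5 h6].
  have h8 : r x <= dquot extension xi k by apply: lower => //; [rewrite gt_eqF | lra | lra].
  by lra.
by apply/andP; split; lra.
Qed.

End ConvexExtension.

(** * Rising and progressing trees *)

(** Neighbours of [q] on one side have denominators that differ by multiples of [denq q], so only
    one of them has a denominator below [denq q]. *)
Lemma farey_parents_uniq (x y x' y' : rat) : farey_neighbours x y ->
  farey_neighbours x' y' -> mediant x y = mediant x' y' -> x = x' /\ y = y'.
Proof.
move=> f f' e.
have uniq b (q z z' : rat) : farey_adjacent b q z -> farey_adjacent b q z' ->
    denq z < denq q -> denq z' < denq q -> z = z'.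
  wlog zz' : z z' / denq z <= denq z' => [H|].
    move=> a a' dz dz'; have [h|/ltW h] := leP (denq z) (denq z'); first exact: H.
    by rewrite (H z' z).
  move=> a a' dz dz'; have [n zE] := adjacent_same_side a a' zz'.
  have [_ _ dn] := adjacent_iter n a.
  case: n zE dn => [->//|n zE]; rewrite -zE mulrS => dn.
  have : 0 <= denq q *+ n by rewrite mulrn_wge0.
  by have := denq_gt0 z; lia.
have [_ dm] := numden_mediant f; have [_ dm'] := numden_mediant f'.
have dx := denq_gt0 x; have dy := denq_gt0 y.
have dx' := denq_gt0 x'; have dy' := denq_gt0 y'.
have d1 : denq x < denq (mediant x y) by rewrite dm; lia.
have d2 : denq y < denq (mediant x y) by rewrite dm; lia.
have d3 : denq x' < denq (mediant x y) by rewrite e dm'; lia.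
have d4 : denq y' < denq (mediant x y) by rewrite e dm'; lia.
split.
- apply: (uniq false (mediant x y)) => //; first exact: farey_mediantl.
  by rewrite e; exact: farey_mediantl.
- apply: (uniq true (mediant x y)) => //; first exact: farey_mediantr.
  by rewrite e; exact: farey_mediantr.
Qed.

(** Descent from (0, 1) to [mediant x y] ends at a pair with that mediant, which is (x, y) by
    uniqueness. *)
Lemma farey_tree_ind (Q : rat -> rat -> Prop) : Q 0 1 ->
  (forall x y, farey_neighbours x y -> Q x y ->
     Q x (mediant x y) /\ Q (mediant x y) y) ->
  forall x y, farey_neighbours x y -> Q x y.
Proof.
move=> Q0 Qs x y f.
have [m0 m1] : 0 <= x /\ y <= 1 by case: f.
have /andP[xm my] := mediant_between f.
have b : 0 < mediant x y < 1 by rewrite (le_lt_trans m0) // (lt_le_trans my).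
have [x' [y' [f' e q]]] : exists x' y', [/\ farey_neighbours x' y',
    mediant x y = mediant x' y' & Q x' y'].
  move: Q0; move: 0 1 (mediant x y) farey01 b => a c u.
  apply: (farey_descent (P := fun a c u => Q a c -> exists x' y',
    [/\ farey_neighbours x' y', u = mediant x' y' & Q x' y'])) => {}a {}c.
  - by move=> fa q; exists a, c.
  - by move=> {}u fa _ IH /(Qs _ _ fa)[q _]; exact: IH.
  - by move=> {}u fa _ IH /(Qs _ _ fa)[_ q]; exact: IH.
by have [-> ->] := farey_parents_uniq f f' e.
Qed.

Lemma disc3C (R : realType) (q y p : R) : disc3 q y p = disc3 y q p.
Proof. by rewrite /disc3; ring. Qed.

(** Let s <= t. On t <= r <= s t / 2 the invariant decreases in r, so it is at most its value at r =
    t, which is 4 + (s - 2) (s + 2 - t^2) < 4. *)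
Lemma disc3_lt4 (R : realType) (r s t : R) : 2 < s -> 2 < t -> s <= r -> t <= r ->
  2 * r <= s * t -> disc3 r s t < 4.
Proof.
wlog st : s t / s <= t => [H s2 t2 sr tr h|].
  have [st|/ltW ts] := leP s t; first exact: H.
  by rewrite (_ : disc3 r s t = disc3 r t s); [apply: H => //; lra | rewrite /disc3; ring].
move=> s2 t2 sr tr h; rewrite /disc3.
have h1 : (r - t) * (r + t - s * t) <= 0.
  rewrite mulr_ge0_le0 ?subr_ge0 //.
  have : 2 * t <= s * t by rewrite ler_pM2r; lra.
  lra.
have h2 : (s - 2) * (s + 2 - t ^+ 2) < 0.
  rewrite pmulr_rlt0 ?subr_gt0 // subr_lt0.
  have : 2 * t <= t ^+ 2 by rewrite expr2 ler_pM2r; lra.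
  lra.
lra.
Qed.

(* If the edge on the root side of a vertex is not directed away from the root,
   then neither is one of its two children, hence a whole infinite path. *)
Lemma not_all_acute (R : realType) (q x y : R) : 2 < q -> 2 < x -> 2 < y ->
  4 <= disc3 x y q -> 2 * q <= x * y -> q * y <= 2 * x \/ q * x <= 2 * y.
Proof.
move=> q2 x2 y2 D4 h.
have [|hx] := leP (q * y) (2 * x); first by left.
have [|hy] := leP (q * x) (2 * y); first by right.
suff : disc3 x y q < 4 by rewrite ltNge D4.
(* The largest label is the [r] of [disc3_lt4]; the two cyclic orders are contradictory. *)
have [xy|yx] := leP x y; have [xq|qx] := leP x q; have [yq|qy] := leP y q.
- by rewrite (_ : disc3 x y q = disc3 q x y); [apply: disc3_lt4 => //; lra | rewrite /disc3; ring].
- by rewrite (_ : disc3 x y q = disc3 y q x); [apply: disc3_lt4 => //; lra | rewrite /disc3; ring].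
- lra.
- by rewrite (_ : disc3 x y q = disc3 y q x); [apply: disc3_lt4 => //; lra | rewrite /disc3; ring].
- by rewrite (_ : disc3 x y q = disc3 q x y); [apply: disc3_lt4 => //; lra | rewrite /disc3; ring].
- lra.
- by rewrite (_ : disc3 x y q = disc3 x q y); [apply: disc3_lt4 => //; lra | rewrite /disc3; ring].
- by rewrite (_ : disc3 x y q = disc3 x q y); [apply: disc3_lt4 => //; lra | rewrite /disc3; ring].
Qed.

Section MarkovTree.
Variables (R : realType) (s0 u0 t0 : R) (T : markov_tree s0 u0 t0).
Let D := discriminator s0 u0 t0.

Lemma label_rec b q y : farey_adjacent b q y ->
  T (mediant q (mediant q y)) = T q * T (mediant q y) - T y.
Proof.
case: b => [|f]; first exact: label_left.
by rewrite [mediant q (_ q _)]mediantC [mediant q y]mediantC (label_right T f) mulrC.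
Qed.

Lemma mediant01 : mediant 0 1 = 1 / 2.
Proof. by []. Qed.

(** Passing to a child replaces one label by the other root of the same quadratic equation. *)
Lemma label_disc b q y : farey_adjacent b q y ->
  disc3 (T q) (T y) (T (mediant q y)) = D.
Proof.
have main x z : farey_neighbours x z -> disc3 (T x) (T z) (T (mediant x z)) = D.
  move: x z; apply: farey_tree_ind => [|x z f <-].
    by rewrite mediant01 label_0 label_1 label_half /disc3 /D /discriminator; ring.
  by rewrite (label_left T f) (label_right T f) /disc3; split; ring.
by case: b => [|f]; [exact: main | rewrite mediantC disc3C; exact: main].
Qed.

(** What the analysis uses of a tree; rising and progressing trees both provide it. *)
Definition regular : Prop :=
  [/\ forall q : rat, 0 <= q <= 1 -> 2 <= T q,
      forall q : rat, 0 < q < 1 -> 2 < T q,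
      4 <= D -> forall b q y, farey_adjacent b q y -> T q * T y < 2 * T (mediant q y) &
      exists N : nat, forall b q y, farey_adjacent b q y ->
        N%:Z <= denq q + denq y -> T q * T y < 2 * T (mediant q y)].

Lemma progressing_regular : progressing T -> regular.
Proof.
move=> [/andP[s2 su] /andP[t2 tu] st].
have main x y : farey_neighbours x y -> [/\ 2 <= T x < T (mediant x y),
   2 <= T y < T (mediant x y) & T x * T y < 2 * T (mediant x y)].
  move: x y; apply: farey_tree_ind => [|x y f [/andP[x2 xm] /andP[y2 ym] h]].
    rewrite mediant01 label_0 label_1 label_half s2 t2 su tu; split=> //.
    (* One of s0, t0 is 2, so half their product is the other one, which is below u0. *)
    by move/eqP: st; rewrite mulf_eq0 !subr_eq0 => /orP[/eqP->|/eqP->]; lra.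
  rewrite (label_left T f) (label_right T f).
  set a := T x in x2 xm h *; set c := T y in y2 ym h *; set m := T _ in xm ym h *.
  have h1 : 2 * m <= a * m by rewrite ler_pM2r; lra.
  have h2 : 2 * m <= m * c by rewrite mulrC ler_pM2l; lra.
  by split; split; try (apply/andP; split); lra.
have T2 q : 0 < q < 1 -> 2 < T q.
  by move=> /farey_parents[x [y [/main[/andP[x2 xm] _ _] ->]]]; exact: le_lt_trans xm.
have dir b q y : farey_adjacent b q y -> T q * T y < 2 * T (mediant q y).
  by case: b => /main[_ _] //; rewrite mulrC mediantC.
split=> //.
- move=> q /andP[]; rewrite le_eqVlt => /orP[/eqP<-|q0]; first by rewrite label_0.
  rewrite le_eqVlt => /orP[/eqP->|q1]; first by rewrite label_1.
  by rewrite ltW // T2 // q0.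
- by exists 0%N => b q y a _; exact: dir a.
Qed.

(** The exceptional path is finite, so it has bounded denominators. For D >= 4 it carries no
    exception: by [not_all_acute] an edge not directed away would be followed by such edges at every
    depth. *)
Lemma rising_regular : rising T -> regular.
Proof.
move=> [T2 [s _ dirs]].
have [N hN] : exists N : nat, forall q, q \in s -> denq q < N%:Z.
  elim: s {dirs} => [|a s [N hN]]; first by exists 0%N.
  exists (N + `|denq a| + 1)%N => q; rewrite inE => /orP[/eqP->|/hN].
    by have := denq_gt0 a; lia.
  by have := denq_gt0 a; lia.
have deep b q y : farey_adjacent b q y -> N%:Z <= denq q + denq y ->
    T q * T y < 2 * T (mediant q y).
  have main x z : farey_neighbours x z -> N%:Z <= denq x + denq z ->
      T x * T z < 2 * T (mediant x z).
    move=> f Nxz; have := dirs x z f; rewrite /directed_away subr_gt0; apply.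
    by apply/negP => /hN; have [_ ->] := numden_mediant f; lia.
  by case: b => f; [exact: main | rewrite mulrC mediantC addrC; exact: main].
have T2' x y : farey_neighbours x y -> [/\ 2 < T x, 2 < T y & 2 < T (mediant x y)].
  move=> f; have [x0 x1 y0 y1] := farey_bounds f.
  have [_ _ m0 m1] := farey_bounds (farey_mediantl f).
  by split; apply: T2; apply/andP.
split=> //; last by exists N.
- by move=> q q01; rewrite ltW // T2.
- by move=> q /andP[q0 q1]; rewrite T2 // !ltW.
move=> D4.
have main x y : farey_neighbours x y -> T x * T y < 2 * T (mediant x y).
  move=> f; rewrite ltNge; apply/negP => nd.
  have [x' [y' [f' nd' hn]]] : exists x' y', [/\ farey_neighbours x' y',
      2 * T (mediant x' y') <= T x' * T y' & N%:Z <= denq x' + denq y'].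
    elim: (N) => [|n [x' [y' [f' nd' hn]]]].
      by exists x, y; split=> //; have := denq_gt0 x; have := denq_gt0 y; lia.
    have [x2 y2 m2] := T2' _ _ f'; have [_ dm] := numden_mediant f'.
    have dx := denq_gt0 x'; have dy := denq_gt0 y'.
    have Dd : 4 <= disc3 (T x') (T y') (T (mediant x' y')).
      by rewrite (@label_disc true).
    case: (not_all_acute m2 x2 y2 Dd nd') => h.
      exists (mediant x' y'), y'; split; [exact: farey_mediantr| |lia].
      by rewrite (label_right T f'); lra.
    exists x', (mediant x' y'); split; [exact: farey_mediantl| |lia].
    by rewrite (label_left T f'); lra.
  by have := @deep true _ _ f' hn; rewrite ltNge nd'.
by case=> q y f; [exact: main | rewrite mulrC mediantC; exact: main].
Qed.

End MarkovTree.

(** * The function Phi *)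

Lemma mu_unique (R : realType) (k : R) : 1 <= k -> mu (k + k^-1) = k.
Proof.
move=> k1; have k0 : 0 < k by exact: lt_le_trans k1.
rewrite /mu (_ : (k + k^-1) ^+ 2 - 4 = (k - k^-1) ^+ 2); last first.
  by field; rewrite gt_eqF.
rewrite sqrtr_sqr ger0_norm; first by field; rewrite gt_eqF.
by rewrite subr_ge0 (le_trans _ k1) // invf_le1.
Qed.

(** For D = 4 the quadratic equation for [p] has the roots 2 cosh (a + b) and 2 cosh (a - b), with
    a, b the logarithms of [mu q], [mu y]; direction excludes the second. *)
Lemma len_additive (R : realType) (q y p : R) : 2 <= q -> 2 <= y ->
  q * y < 2 * p -> disc3 q y p = 4 -> ln (mu p) = ln (mu q) + ln (mu y).
Proof.
move=> q2 y2 h D4.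
have kq := mu_ge1 q2; have ky := mu_ge1 y2; have kq0 := mu_gt0 q2; have ky0 := mu_gt0 y2.
have k1 : 1 <= mu q * mu y by rewrite -[1]mulr1 ler_pM.
suff -> : p = mu q * mu y + (mu q * mu y)^-1 by rewrite mu_unique // lnM.
have /eqP : (p - (mu q * mu y + (mu q * mu y)^-1)) * (p - (mu q / mu y + mu y / mu q)) = 0.
  have : disc3 q y p - 4 = 0 by rewrite D4 subrr.
  rewrite /disc3; have := mu_sum q2; have := mu_sum y2.
  move: kq0 ky0; set k := mu q; set j := mu y => k0 j0 <- <- e.
  by rewrite -e; field; rewrite !gt_eqF.
rewrite mulf_eq0 !subr_eq0 => /orP[/eqP//|/eqP pE]; exfalso.
have [iq iy] : (mu q)^-1 <= 1 /\ (mu y)^-1 <= 1 by rewrite !invf_le1.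
have dq : 0 <= mu q - (mu q)^-1 by lra.
have dy : 0 <= mu y - (mu y)^-1 by lra.
move: h; rewrite pE -[X in X * y](mu_sum q2) -[X in _ * X](mu_sum y2).
by have := mulr_ge0 dq dy; lra.
Qed.

Section Regular.
Variables (R : realType) (s0 u0 t0 : R) (T : markov_tree s0 u0 t0).
Let D := discriminator s0 u0 t0.
Hypothesis T_reg : regular T.

Lemma reg_ge2 (q : rat) : 0 <= q <= 1 -> 2 <= T q.
Proof. by case: T_reg => h _ _ _; exact: h. Qed.

Lemma reg_gt2 (q : rat) : 0 < q < 1 -> 2 < T q.
Proof. by case: T_reg => _ h _ _; exact: h. Qed.

Lemma reg_len_ge0 (q : rat) : 0 <= q <= 1 -> 0 <= len T q.
Proof. by move=> q01; rewrite /len ln_ge0 // mu_ge1 // reg_ge2. Qed.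

(** Both sides add up under mediants: the left by [len_additive], the right because it is linear in
    numerator and denominator. *)
Lemma parabolic_affine (q : rat) : D = 4 -> 0 <= q <= 1 ->
  len T q = den R q * ((1 - ratr q) * len T 0 + ratr q * len T 1).
Proof.
move=> D4; pose L (q : rat) := den R q * ((1 - ratr q) * len T 0 + ratr q * len T 1).
have LE x : L x = (den R x - (numq x)%:~R) * len T 0 + (numq x)%:~R * len T 1.
  by rewrite /L -ratr_den; ring.
have main x y : farey_neighbours x y -> len T x = L x /\ len T y = L y.
  have L0 : len T 0 = L 0 by rewrite /L rmorph0 (_ : den R 0 = 1) //; ring.
  have L1 : len T 1 = L 1 by rewrite /L rmorph1 (_ : den R 1 = 1) //; ring.
  move: x y; apply: farey_tree_ind => // x y f [hx hy].
  have [x0 x1 y0 y1] := farey_bounds f.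
  suff -> : len T (mediant x y) = L (mediant x y) by [].
  have [nm dm] := numden_mediant f.
  have a : farey_adjacent true x y by [].
  have -> : L (mediant x y) = L x + L y by rewrite !LE /den nm dm !rmorphD /=; ring.
  rewrite -hx -hy /len; case: T_reg => T2 _ Td _.
  apply: len_additive; [by rewrite T2 ?x0|by rewrite T2 ?y0| |].
    by apply: (Td _ _ _ _ a); rewrite -/D D4.
  by rewrite (label_disc T a).
move=> /andP[]; rewrite le_eqVlt => /orP[/eqP<-|q0].
  by move=> _; exact: (main _ _ farey01).1.
rewrite le_eqVlt => /orP[/eqP->|q1]; first exact: (main _ _ farey01).2.
have [|x [y [f ->]]] := @farey_parents q; first by rewrite q0.
exact: (main _ _ (farey_mediantl f)).2.
Qed.

Lemma cosh_len (q : rat) : 0 <= q <= 1 -> T q = 2 * cosh (len T q).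
Proof. by move=> q01; rewrite /len cosh_ln_mu // reg_ge2. Qed.

(** * The case [D != 4] *)

Section NonParabolic.
Hypothesis D4 : D != 4.

Let g := nlen T D.
Let l := side_slope T D false.
Let r := side_slope T D true.
Let good (q : rat) : Prop := 2 < T q.
Let s := sgD D.
Definition Gext : R -> R := extension g l r good.
(** [Gext] extends the signed [nlen]; as the sign squares to 1, multiplying by it again removes
    it. *)
Definition Phi_of (x : R) : R := s * Gext x.

Let rec := label_rec T.
Let disc b q y a := @label_disc R s0 u0 t0 T b q y a.
Let dir : 4 <= D -> forall b q y, farey_adjacent b q y -> T q * T y < 2 * T (mediant q y).
Proof. by case: T_reg. Qed.

Let good_int (q : rat) : 0 < q < 1 -> good q. Proof. exact: reg_gt2. Qed.

Let sbounds x u : 0 <= x -> x < u -> u <= 1 ->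
  (good x -> r x <= slope g x u) /\ (good u -> slope g x u <= l u).
Proof. exact: (side_slope_bounds rec disc reg_ge2 reg_gt2 dir D4). Qed.

Let l_lt_r q : 0 < q < 1 -> l q < r q.
Proof. exact: (side_slope_lt rec disc reg_ge2 reg_gt2 dir D4). Qed.

Lemma not_good (v : rat) : 0 <= v <= 1 -> ~ good v -> T v = 2 /\ (v = 0 \/ v = 1).
Proof.
move=> v01 nv; have := reg_ge2 v01; rewrite le_eqVlt => /orP[/eqP e|//].
split=> //; have [|vn0] := eqVneq v 0; first by left.
have [|vn1] := eqVneq v 1; first by right.
case: nv; apply: good_int; case/andP: v01 => v0 v1.
by rewrite !lt_neqAle eq_sym vn0 vn1 v0 v1.
Qed.

Let etangent v (e : R) : 0 <= v <= 1 -> ~ good v -> 0 < e ->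
  exists q : rat, 0 < q < 1 /\ g v - e < g q + r q * (ratr v - ratr q).
Proof.
move=> v01 nv e0; have [Tv v0or1] := not_good v01 nv.
have gv : g v = 0 by have [] := len_parabolic D Tv.
have [b [w a]] : exists b w, farey_adjacent b v w.
  by case: v0or1 => ->; [exists true, 1 | exists false, 0].
have [q h] := parabolic_tangent rec disc reg_ge2 reg_gt2 dir D4 a Tv e0.
by exists q; rewrite gv sub0r.
Qed.

Lemma Gext_rat (p : rat) : 0 <= p <= 1 -> Gext (ratr p) = g p.
Proof. exact: (extension_rat good_int sbounds l_lt_r etangent). Qed.

Let conv : forall x y t : R, 0 <= x -> x < y -> y <= 1 -> 0 <= t <= 1 ->
  Gext ((1 - t) * x + t * y) <= (1 - t) * Gext x + t * Gext y.
Proof. exact: (extension_convex good_int sbounds l_lt_r). Qed.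

Lemma sgD_sqr : s * s = 1.
Proof.
rewrite /s /sgD; have [h|h|h] := ltgtP D 4; last by move: D4; rewrite h eqxx.
  by rewrite gtr0_sg ?subr_gt0 ?mulr1.
by rewrite ltr0_sg ?subr_lt0 // mulrNN mulr1.
Qed.

Lemma normr_sgD (x : R) : `|s * x| = `|x|.
Proof. by rewrite normrM /s /sgD normr_sg subr_eq0 eq_sym D4 mul1r. Qed.

Lemma Phi_rat (p : rat) : 0 <= p <= 1 -> den R p * Phi_of (ratr p) = len T p.
Proof.
move=> p01; rewrite /Phi_of Gext_rat // /g /nlen -/s !mulrA -(mulrA _ s s) sgD_sqr mulr1.
by rewrite mulrC mulKf // gt_eqF // den_gt0.
Qed.

Lemma Phi_dist (x e : R) : 0 <= x <= 1 -> 0 < e -> exists2 d, 0 < d &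
  forall y, 0 <= y <= 1 -> `|y - x| < d -> `|Phi_of y - Phi_of x| < e.
Proof.
move=> x01 e0.
have [d d0 Hd] := extension_continuous good_int sbounds l_lt_r x01 e0.
by exists d => // y y01 yx; rewrite /Phi_of -mulrBr normr_sgD; exact: Hd.
Qed.

Lemma Phi_ge0 (x : R) : 0 <= x <= 1 -> 0 <= Phi_of x.
Proof.
move=> x01.
(* Nonnegativity at rationals carries over by continuity and density. *)
have rat0 (p : rat) : 0 <= p <= 1 -> 0 <= Phi_of (ratr p).
  by move=> p01; rewrite -(pmulr_rge0 _ (den_gt0 R p)) Phi_rat // reg_len_ge0.
have [x0 x1] := andP x01.
move: x1; rewrite le_eqVlt => /orP[/eqP->|x1].
  by rewrite -(rmorph1 (@ratr R)); exact: rat0.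
rewrite leNgt; apply/negP => neg.
have neg' : 0 < - Phi_of x by rewrite oppr_gt0.
have [d d0 Hd] := Phi_dist x01 neg'.
have xm : x < Num.min 1 (x + d) by rewrite lt_min x1 ltrDl.
have [q /andP[xq]] := rat_between xm.
rewrite lt_min => /andP[q1 qd].
have q01 : 0 <= (ratr q : R) <= 1 by rewrite !ltW // (le_lt_trans x0).
have := Hd (ratr q) q01; rewrite gtr0_norm ?subr_gt0 // => h.
have h2 : ratr q - x < d by lra.
have := h h2; rewrite ltr_norml => /andP[_ h3].
have := rat0 q; rewrite -(ratr01 R) => /(_ q01); lra.
Qed.

Let quotPhi (x h : R) : h^-1 * (Phi_of (x + h) - Phi_of x) = s * dquot Gext x h.
Proof. by rewrite /Phi_of /dquot; ring. Qed.

Lemma Phi_derivable (xi : R) : 0 < xi < 1 -> irrational xi -> derivable Phi_of xi 1.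
Proof.
move=> xi01 irr.
have gap e : 0 < e -> exists x y : rat,
   [/\ 0 < x, y < 1, ratr x < xi < ratr y & l y - r x < e].
  have deep : exists N : nat, forall b q y, farey_adjacent b q y ->
    N%:Z <= denq q + denq y -> T q * T y < 2 * T (mediant q y) by case: T_reg.
  exact: (irrational_gap rec disc reg_ge2 reg_gt2 dir deep D4).
have [L HL] := extension_irrational good_int sbounds l_lt_r etangent xi01 gap.
apply: (@derivable_dist _ _ _ (s * L)) => e e0; have [d d0 Hd] := HL e e0.
by exists d => // h h0 hd; rewrite quotPhi -mulrBr normr_sgD; exact: Hd.
Qed.

Lemma Phi_right (q : rat) : 0 <= q < 1 -> 2 < T q ->
  exists L, r q <= L /\ has_right_derivative Phi_of (ratr q) (s * L)%:E.
Proof.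
move=> /andP[q0 q1] gq.
have q0R : 0 <= ratr q :> R by rewrite -(rmorph0 (@ratr R)) ler_rat.
have q1R : ratr q < 1 :> R by rewrite -(rmorph1 (@ratr R)) ltr_rat.
have [|L [rL _ HL]] := right_limit conv (c := r q) q0R q1R.
  move=> h h0 h1; rewrite /dquot ler_pdivlMl // mulrC.
  have qh : ratr q < ratr q + h by rewrite ltrDl.
  have := extension_slope_right good_int sbounds l_lt_r etangent q0 gq qh h1.
  by rewrite addrAC subrr add0r.
exists L; split=> //; apply: has_right_derivativeP => e e0.
have [d d0 Hd] := HL e e0; exists d => // h h0 hd.
by rewrite quotPhi -mulrBr normr_sgD; exact: Hd.
Qed.

Lemma Phi_left (q : rat) : 0 < q <= 1 -> 2 < T q ->
  exists L, L <= l q /\ has_left_derivative Phi_of (ratr q) (s * L)%:E.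
Proof.
move=> /andP[q0 q1] gq.
have q0R : 0 < ratr q :> R by rewrite -(rmorph0 (@ratr R)) ltr_rat.
have q1R : ratr q <= 1 :> R by rewrite -(rmorph1 (@ratr R)) ler_rat.
have [|L [rL _ HL]] := left_limit conv (c := l q) q0R q1R.
  move=> h h0 h1; rewrite /dquot ler_ndivrMl // mulrC.
  have qh : ratr q + h < ratr q by rewrite gtrDl.
  have := extension_slope_left good_int sbounds l_lt_r etangent q1 gq qh h1.
  by rewrite -/Gext; lra.
exists L; split=> //; apply: has_left_derivativeP => e e0.
have [d d0 Hd] := HL e e0; exists d => // h h0 hd.
by rewrite quotPhi -mulrBr normr_sgD; exact: Hd.
Qed.

(** The derivatives are s L and s M with L <= l q < r q <= M. *)
Lemma Phi_corner (q : rat) (a b : R) : 0 < q < 1 ->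
  has_left_derivative Phi_of (ratr q) a%:E ->
  has_right_derivative Phi_of (ratr q) b%:E -> a <> b.
Proof.
move=> q01 ha hb ab; have gq := reg_gt2 q01; have [q0 q1] := andP q01.
have [L [Ll hL]] : exists L, L <= l q /\ has_left_derivative Phi_of (ratr q) (s * L)%:E.
  by apply: Phi_left gq; rewrite q0 ltW.
have [M [rM hM]] : exists L, r q <= L /\ has_right_derivative Phi_of (ratr q) (s * L)%:E.
  by apply: Phi_right gq; rewrite q1 ltW.
have aE := has_left_derivative_unique ha hL.
have bE := has_right_derivative_unique hb hM.
have : s * (s * L) = s * (s * M) by rewrite -aE -bE ab.
rewrite !mulrA sgD_sqr !mul1r => LM.
by have := l_lt_r q01; rewrite ltNge (le_trans rM) // -LM.
Qed.

Let slope_dquot (v u : rat) : 0 <= v <= 1 -> 0 <= u <= 1 ->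
  slope g v u = dquot Gext (ratr v) (ratr u - ratr v).
Proof.
move=> v01 u01; rewrite /dquot (_ : ratr v + (ratr u - ratr v) = ratr u); last by ring.
by rewrite !Gext_rat // /slope mulrC.
Qed.

(** [parabolic_slope] gives a chord of [Gext] from 0 with slope below -M; difference quotients for
    smaller h are no larger, and s = -1 because D > 4. *)
Lemma Phi_right0 : T 0 = 2 -> has_right_derivative Phi_of 0 +oo%E.
Proof.
move=> T0; apply: has_right_derivativeyP => M.
have a : farey_adjacent true 0 1 by [].
have [_ [_ D4'] _] := parabolic_labels rec disc dir D4 a T0.
have sE : s = -1 by rewrite /s /sgD ltr0_sg // subr_lt0.
have [u [ge0u leu1 vu hM]] := parabolic_slope rec disc reg_ge2 dir D4 M a T0.
have u01 : 0 <= u <= 1 by rewrite ge0u.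
have e : slope g 0 u = dquot Gext 0 (ratr u).
  by rewrite slope_dquot // rmorph0 subr0.
have u0R : 0 < ratr u :> R by rewrite -(rmorph0 (@ratr R)) ltr_rat.
have u1R : ratr u <= 1 :> R by rewrite -(rmorph1 (@ratr R)) ler_rat.
exists (ratr u) => // h h0 hu; rewrite quotPhi sE.
have : dquot Gext 0 h <= dquot Gext 0 (ratr u).
  by apply: (dquot_mono conv); [| | | |rewrite gt_eqF|rewrite gt_eqF|]; lra.
by move: hM; rewrite -/g e expr1; lra.
Qed.

Lemma Phi_left1 : T 1 = 2 -> has_left_derivative Phi_of 1 -oo%E.
Proof.
move=> T1; apply: has_left_derivativeNyP => M.
have a : farey_adjacent false 1 0 by [].
have [_ [_ D4'] _] := parabolic_labels rec disc dir D4 a T1.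
have sE : s = -1 by rewrite /s /sgD ltr0_sg // subr_lt0.
have [u [ge0u leu1 vu hM]] := parabolic_slope rec disc reg_ge2 dir D4 (- M) a T1.
have u01 : 0 <= u <= 1 by rewrite ge0u.
have e : slope g 1 u = dquot Gext 1 (ratr u - 1).
  by rewrite slope_dquot // rmorph1.
have u0R : 0 <= ratr u :> R by rewrite -(rmorph0 (@ratr R)) ler_rat.
have u1R : ratr u < 1 :> R by rewrite -(rmorph1 (@ratr R)) ltr_rat.
exists (1 - ratr u); first by rewrite subr_gt0.
move=> h h0 hu; rewrite quotPhi sE.
have : dquot Gext 1 (ratr u - 1) <= dquot Gext 1 h.
  by apply: (dquot_mono conv); [| | | |rewrite lt_eqF|rewrite lt_eqF|]; lra.
by move: hM; rewrite -/g e expr0; lra.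
Qed.

Lemma Phi_strict x y t : 0 <= x -> x < y -> y <= 1 -> 0 < t < 1 ->
  Gext ((1 - t) * x + t * y) < (1 - t) * Gext x + t * Gext y.
Proof. exact: (extension_strict good_int sbounds l_lt_r etangent). Qed.

End NonParabolic.
End Regular.

Theorem theorem1p1 (R : realType) (s0 u0 t0 : R) (T : markov_tree s0 u0 t0)
    (hT : rising T \/ progressing T) :
  let D := discriminator s0 u0 t0 in
  exists Phi : R -> R,
    {within `[0, 1], continuous Phi} /\
    (forall x : R, 0 <= x <= 1 -> 0 <= Phi x) /\
    (forall q : rat, 0 <= q <= 1 ->
       T q = 2 * cosh ((denq q)%:~R * Phi (ratr q))) /\
    (D < 4 -> strictly_convex_on 0 1 Phi) /\
    (D = 4 -> affine_on 0 1 Phi) /\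
    (4 < D -> strictly_concave_on 0 1 Phi) /\
    (forall x : R, 0 < x < 1 -> irrational x -> derivable Phi x 1) /\
    (D <> 4 ->
       (forall q : rat, 0 < q <= 1 -> ~ (q = 1 /\ T 1 = 2) ->
          exists l : R, has_left_derivative Phi (ratr q) l%:E) /\
       (T 1 = 2 -> has_left_derivative Phi 1 -oo%E) /\
       (forall q : rat, 0 <= q < 1 -> ~ (q = 0 /\ T 0 = 2) ->
          exists l : R, has_right_derivative Phi (ratr q) l%:E) /\
       (T 0 = 2 -> has_right_derivative Phi 0 +oo%E) /\
       (forall (q : rat) (l r : R), 0 < q < 1 ->
          has_left_derivative Phi (ratr q) l%:E ->
          has_right_derivative Phi (ratr q) r%:E -> l <> r)).
Proof.
move=> D.
have reg : regular T by case: hT => [/rising_regular|/progressing_regular].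
have [D4|D4] := eqVneq D 4.
  pose Phi (x : R) := (1 - x) * len T 0 + x * len T 1.
  have lin (x y : R) : Phi y - Phi x = (y - x) * (len T 1 - len T 0).
    by rewrite /Phi; ring.
  exists Phi; split; [|split; [|split; [|split; [|split; [|split; [|split]]]]]].
  - apply: continuous01_dist => x e _ e0.
    (* The summand 1 keeps [K] positive when the line is horizontal. *)
    pose K := `|len T 1 - len T 0| + 1.
    have K0 : 0 < K by rewrite ltr_wpDl.
    exists (e / K); first by rewrite divr_gt0.
    move=> y _; rewrite lin normrM ltr_pdivlMr // => h.
    by apply: le_lt_trans h; rewrite ler_wpM2l // lerDl.
  - move=> x /andP[x0 x1].
    by rewrite addr_ge0 // mulr_ge0 ?subr_ge0 // (reg_len_ge0 reg).
  - by move=> q q01; rewrite {1}(cosh_len reg q01) (parabolic_affine reg D4 q01).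
  - by rewrite D4 ltxx.
  - by move=> _; exists (len T 1 - len T 0), (len T 0) => x _; rewrite /Phi; ring.
  - by rewrite D4 ltxx.
  - move=> x _ _; apply: (@derivable_dist _ _ _ (len T 1 - len T 0)) => e e0.
    exists 1 => // h h0 _; by rewrite lin addrAC subrr add0r mulKf // subrr normr0.
  - by move=> /(_ D4).
exists (Phi_of T); split; [|split; [|split; [|split; [|split; [|split; [|split]]]]]].
- by apply: continuous01_dist => x e; exact: (Phi_dist reg D4).
- by move=> x; exact: (Phi_ge0 reg D4).
- by move=> q q01; rewrite -/(den R q) (Phi_rat reg D4 q01) -(cosh_len reg q01).
- move=> Dlt x y t x0 xy y1 t01; rewrite /Phi_of /sgD gtr0_sg ?subr_gt0 // !mul1r.
  exact: (Phi_strict reg D4).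
- by move/eqP: D4.
- move=> Dgt x y t x0 xy y1 t01; rewrite /Phi_of /sgD ltr0_sg ?subr_lt0 //.
  by have := Phi_strict reg D4 x0 xy y1 t01; lra.
- by move=> x; exact: (Phi_derivable reg D4).
move=> _; split; [|split; [|split; [|split]]].
- move=> q /andP[q0 q1] h.
  have q01 : 0 < q <= 1 by rewrite q0.
  have Tq : 2 < T q.
    have q01' : 0 <= q <= 1 by rewrite ltW.
    rewrite lt_neqAle (reg_ge2 reg q01') andbT; apply/eqP => T2.
    move: q1; rewrite le_eqVlt => /orP[/eqP e|q1]; first by apply: h; rewrite -e.
    have q11 : 0 < q < 1 by rewrite q0.
    by have := reg_gt2 reg q11; rewrite -T2 ltxx.
  by have [L [_ hL]] := Phi_left reg D4 q01 Tq; exists (sgD D * L).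
- exact: (Phi_left1 reg D4).
- move=> q /andP[q0 q1] h.
  have q01 : 0 <= q < 1 by rewrite q0.
  have Tq : 2 < T q.
    have q01' : 0 <= q <= 1 by rewrite q0 ltW.
    rewrite lt_neqAle (reg_ge2 reg q01') andbT; apply/eqP => T2.
    move: q0; rewrite le_eqVlt => /orP[/eqP e|q0]; first by apply: h; rewrite e.
    have q11 : 0 < q < 1 by rewrite q0.
    by have := reg_gt2 reg q11; rewrite -T2 ltxx.
  by have [L [_ hL]] := Phi_right reg D4 q01 Tq; exists (sgD D * L).
- exact: (Phi_right0 reg D4).
- by move=> q l r; exact: (Phi_corner reg D4).
Qed.
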